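(* Let $K$ be a field and $T\in K^{m_1}\otimes K^{m_2}\otimes K^{m_3}$. All Kronecker powers $T^{\otimes k}$ ($k\ge1$) are semistable if and only if $G_\xi(T)=\min_i m_i^{1/\xi_i}$ for every $\xi\in\Xi$.
   Context: For $K$ algebraically closed, a tensor in $V_1\otimes V_2\otimes V_3$ is semistable if the Zariski closure of its orbit under $\mathrm{SL}(V_1)\times\mathrm{SL}(V_2)\times\mathrm{SL}(V_3)$ does not contain $0$; for general $K$, a tensor is semistable if it is semistable after extending scalars to the algebraic closure $\overline K$. $T^{\otimes k}\in(K^{m_1})^{\otimes k}\otimes(K^{m_2})^{\otimes k}\otimes(K^{m_3})^{\otimes k}$ is the Kronecker power. $\Xi=\{\xi\in\mathbb{R}^3_{\ge0}:\max_i\xi_i=1\}$; convention $m_i^{1/\xi_i}=+\infty$ if $\xi_i=0$. An $i$-slice: tensor whose $i$-th flattening has matrix rank one; slice decomposition of size $(r_1,r_2,r_3)$: sum of $r_i$ $i$-slices. $S_\xi(T)=\min\sum_ir_i^{1/\xi_i}$ ($\xi_i=0$ forces $r_i=0$, term omitted); $G_\xi(T)=\limsup_nS_\xi(T^{\otimes n})^{1/n}$. *)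

(* Defs.v *)
From HB Require Import structures.
From mathcomp Require Import all_boot all_order all_algebra.
From mathcomp Require Import all_classical all_reals all_analysis.
(* Not imported: the notations of mpoly clash with those of the analysis
   library. *)
From mathcomp Require mpoly.

Set Implicit Arguments.
Unset Strict Implicit.
Unset Printing Implicit Defensive.

Import Order.TTheory GRing.Theory Num.Theory.
Import numFieldNormedType.Exports.

Local Open Scope classical_set_scope.
Local Open Scope ring_scope.

(* Elements of K^m1 (x) K^m2 (x) K^m3, by coordinates in the standard basis. *)
Notation tensor K m1 m2 m3 := {ffun 'I_m1 * 'I_m2 * 'I_m3 -> K}.

(* The standard basis of (K^m)^(x)k is indexed by the words
   {ffun 'I_k -> 'I_m}, numbered from 0 to m ^ k - 1 by [enum_val]. *)
Definition word (k m : nat) (a : 'I_#|{ffun 'I_k -> 'I_m}|) :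
    {ffun 'I_k -> 'I_m} := enum_val a.

Definition kronecker_power (K : fieldType) (m1 m2 m3 : nat)
    (T : tensor K m1 m2 m3) (k : nat) :
    tensor K #|{ffun 'I_k -> 'I_m1}| #|{ffun 'I_k -> 'I_m2}|
             #|{ffun 'I_k -> 'I_m3}| :=
  [ffun x => \prod_(s < k)
     T (word x.1.1 s, word x.1.2 s, word x.2 s)].

(* The closure V(I(S)) of S in the affine space L^I: the common zeros of all
   the polynomials that vanish on S. *)
Definition zariski_closure (L : fieldType) (I : finType)
    (S : set {ffun I -> L}) : set {ffun I -> L} :=
  [set x | forall p : mpoly.mpoly #|I| L,
     (forall y, S y -> mpoly.meval (fun i => y (enum_val i)) p = 0) ->
     mpoly.meval (fun i => x (enum_val i)) p = 0].

Definition tensor_act (L : fieldType) (m1 m2 m3 : nat)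
    (g1 : 'M[L]_m1) (g2 : 'M[L]_m2) (g3 : 'M[L]_m3)
    (T : tensor L m1 m2 m3) : tensor L m1 m2 m3 :=
  [ffun x => \sum_(i < m1) \sum_(j < m2) \sum_(k < m3)
     g1 x.1.1 i * g2 x.1.2 j * g3 x.2 k * T (i, j, k)].

Definition SL_orbit (L : fieldType) (m1 m2 m3 : nat)
    (T : tensor L m1 m2 m3) : set (tensor L m1 m2 m3) :=
  [set U | exists (g1 : 'M[L]_m1) (g2 : 'M[L]_m2) (g3 : 'M[L]_m3),
     [/\ \det g1 = 1, \det g2 = 1, \det g3 = 1 &
         U = tensor_act g1 g2 g3 T]].

Definition semistable_closed (L : closedFieldType) (m1 m2 m3 : nat)
    (T : tensor L m1 m2 m3) : Prop :=
  ~ zariski_closure (SL_orbit T) (0 : tensor L m1 m2 m3).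

Definition is_algebraic_closure (K : fieldType) (Kbar : closedFieldType)
    (iota : {rmorphism K -> Kbar}) : Prop :=
  forall x : Kbar, algebraicOver iota x.

(* To be used when [iota] is an algebraic closure of K. *)
Definition semistable (K : fieldType) (Kbar : closedFieldType)
    (iota : {rmorphism K -> Kbar}) (m1 m2 m3 : nat)
    (T : tensor K m1 m2 m3) : Prop :=
  semistable_closed ([ffun x => iota (T x)] : tensor Kbar m1 m2 m3).

Section Slices.
Variables (K : fieldType) (m1 m2 m3 : nat).
Implicit Type T : tensor K m1 m2 m3.

Definition flattening1 T : 'M[K]_(m1, m2 * m3) :=
  \matrix_(i < m1) mxvec (\matrix_(j < m2, k < m3) T (i, j, k)).
Definition flattening2 T : 'M[K]_(m2, m1 * m3) :=
  \matrix_(j < m2) mxvec (\matrix_(i < m1, k < m3) T (i, j, k)).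
Definition flattening3 T : 'M[K]_(m3, m1 * m2) :=
  \matrix_(k < m3) mxvec (\matrix_(i < m1, j < m2) T (i, j, k)).

Definition slice1 T : Prop := \rank (flattening1 T) = 1%N.
Definition slice2 T : Prop := \rank (flattening2 T) = 1%N.
Definition slice3 T : Prop := \rank (flattening3 T) = 1%N.

Definition has_slice_decomposition T (r1 r2 r3 : nat) : Prop :=
  exists (A : 'I_r1 -> tensor K m1 m2 m3) (B : 'I_r2 -> tensor K m1 m2 m3)
         (C : 'I_r3 -> tensor K m1 m2 m3),
    [/\ forall a, slice1 (A a), forall b, slice2 (B b),
        forall c, slice3 (C c) &
        T = \sum_(a < r1) A a + \sum_(b < r2) B b + \sum_(c < r3) C c].

End Slices.

Definition Xi (R : realType) : set (R * R * R) :=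
  [set xi | [/\ 0 <= xi.1.1, 0 <= xi.1.2, 0 <= xi.2 &
                Num.max (Num.max xi.1.1 xi.1.2) xi.2 = 1]].

(* r^(1/x), omitted (that is, 0) when x = 0. *)
Definition slice_term (R : realType) (x : R) (r : nat) : R :=
  if x == 0 then 0 else r%:R `^ x^-1.

(* For xi in Xi the set below is nonempty and consists of values of a sum of
   unbounded increasing functions of the r_i, so its infimum is a minimum. *)
Definition weighted_slice_rank (R : realType) (xi : R * R * R) (K : fieldType)
    (m1 m2 m3 : nat) (T : tensor K m1 m2 m3) : R :=
  inf [set s : R | exists r1 r2 r3 : nat,
    [/\ has_slice_decomposition T r1 r2 r3,
        [/\ xi.1.1 = 0 -> r1 = 0%N, xi.1.2 = 0 -> r2 = 0%N &
            xi.2 = 0 -> r3 = 0%N] &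
        s = slice_term xi.1.1 r1 + slice_term xi.1.2 r2
            + slice_term xi.2 r3]].

Definition asymptotic_slice_rank (R : realType) (xi : R * R * R)
    (K : fieldType) (m1 m2 m3 : nat) (T : tensor K m1 m2 m3) : \bar R :=
  limn_esup (fun n : nat =>
    (weighted_slice_rank xi (kronecker_power T n) `^ n%:R^-1)%:E).

(* m^(1/x), with value +oo when x = 0. *)
Definition dim_term (R : realType) (x : R) (m : nat) : \bar R :=
  if x == 0 then +oo%E else (m%:R `^ x^-1)%:E.

Definition min_dim_term (R : realType) (xi : R * R * R) (m1 m2 m3 : nat) :
    \bar R :=
  Order.min (Order.min (dim_term xi.1.1 m1) (dim_term xi.1.2 m2))
            (dim_term xi.2 m3).

(* Main.v *)
(** Easy direction. If the asymptotic slice rank is below the minimum, some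
    Kronecker power, of format M1 x M2 x M3, has a slice decomposition with
    sum r_i / M_i < 1; in bases adapted to it, a one-parameter subgroup of
    SL x SL x SL contracts the power to 0.

    Converse. If 0 is in the closure of the SL-orbit of a Kronecker power T',
    then Chevalley's extension theorem gives a valuation ring O, in the function
    field of GL x GL x GL, in which the generic translate of T' becomes 0
    modulo the maximal ideal. By the Cartan decomposition over O, the valuations
    of the diagonal part weight the coordinates, with mean 0 in each direction,
    so that h T', for some h in GL(O)^3, only has entries of positive weight
    modulo the maximal ideal; Fourier-Motzkin elimination makes the weights
    real. In the q-th power of h T' the words of length q with average weight at
    least eps, exponentially rare by Chernoff's bound, index slices that
    suffice. The entries of the q-th power of h^-1 depend on joint types of
    words only, so the slices can be taken over K itself at the cost of a factor
    polynomial in q. For xi_i proportional to log m_i this contradicts the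
    equality. *)

Require Import Defs.
From HB Require Import structures.
From mathcomp Require Import all_boot all_order all_algebra.
From mathcomp Require Import all_classical all_reals all_analysis.
From mathcomp Require Import perm ring lra zify.
From mathcomp Require Import -(notations) mpoly.

Set Implicit Arguments.
Unset Strict Implicit.
Unset Printing Implicit Defensive.

Import Order.TTheory GRing.Theory Num.Theory.
Import numFieldNormedType.Exports.

Local Open Scope classical_set_scope.
Local Open Scope ring_scope.

(** * Chevalley's extension theorem *)

(** The obstacle is that the orbit closure lives over [Kbar], while slices must be found over K. A
    valuation ring needs no curve inside the orbit closure, but its value group is arbitrary and h
    is defined over a field F much larger than K. The value group does no harm: only finitely many
    strict inequalities between valuations matter, and if they had no real solution, a product of
    elements of the maximal ideal would be 1. The field F does no harm either: the slices of the
    powers are cut out by 0-1 linear forms, and the trilinear form of a power, on vectors over K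
    annihilated by these forms, takes a value in K that lies in the maximal ideal. Nonzero elements
    of K are units of O, so this value is 0; the residue field is never formed. Since G_xi is a
    limsup, a slice bound is required for all large exponents, not only for multiples of k. *)

Definition is_subring (F : fieldType) (A : set F) : Prop :=
  [/\ A 1, forall x y, A x -> A y -> A (x - y) &
      forall x y, A x -> A y -> A (x * y)].

Section Subring.
Variables (F : fieldType) (A : set F).
Hypothesis ringA : is_subring A.

Lemma subring1 : A 1. Proof. by case: ringA. Qed.

Lemma subringB x y : A x -> A y -> A (x - y).
Proof. by case: ringA => _ + _; apply. Qed.

Lemma subringM x y : A x -> A y -> A (x * y).
Proof. by case: ringA => _ _; apply. Qed.

Lemma subring0 : A 0.
Proof. by rewrite -(subrr 1); apply: subringB; exact: subring1. Qed.

Lemma subringN x : A x -> A (- x).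
Proof. by move=> Ax; rewrite -sub0r; apply: subringB => //; exact: subring0. Qed.

Lemma subringD x y : A x -> A y -> A (x + y).
Proof. by move=> Ax Ay; rewrite -[y]opprK; apply: subringB => //; exact: subringN. Qed.

Lemma subring_sum (I : Type) (r : seq I) (P : pred I) (f : I -> F) :
  (forall i, P i -> A (f i)) -> A (\sum_(i <- r | P i) f i).
Proof.
by move=> Af; apply: (big_ind A) => //; [exact: subring0|exact: subringD].
Qed.

Lemma subring_prod (I : Type) (r : seq I) (P : pred I) (f : I -> F) :
  (forall i, P i -> A (f i)) -> A (\prod_(i <- r | P i) f i).
Proof.
by move=> Af; apply: (big_ind A) => //; [exact: subring1|exact: subringM].
Qed.

Lemma subringX x n : A x -> A (x ^+ n).
Proof.
by move=> Ax; elim: n => [|n IH]; rewrite ?expr0 ?exprS;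
  [exact: subring1|exact: subringM].
Qed.

End Subring.

Definition is_valuation_ring (F : fieldType) (O : set F) : Prop :=
  is_subring O /\ forall x, O x \/ O x^-1.

(** Inversion is total with 0^-1 = 0, which lies in O, so 0 has to be added to the elements whose
    inverse is outside O. *)
Definition maximal_ideal (F : fieldType) (O : set F) : set F :=
  [set x | x = 0 \/ ~ O x^-1].

Section ChevalleyExtension.
Variables (F : fieldType) (I : finType) (w : I -> F).

Definition span_ideal (A : set F) : set F :=
  [set x | exists2 a : I -> F, (forall i, A (a i)) & x = \sum_i a i * w i].

Lemma span_idealD A x y : is_subring A ->
  span_ideal A x -> span_ideal A y -> span_ideal A (x + y).
Proof.
move=> ringA [a Aa ->] [b Ab ->]; exists (fun i => a i + b i) => [i|].
  exact: subringD.
by rewrite -big_split /=; apply: eq_bigr => i _; rewrite mulrDl.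
Qed.

Lemma span_idealM A x y : is_subring A ->
  A x -> span_ideal A y -> span_ideal A (x * y).
Proof.
move=> ringA Ax [b Ab ->]; exists (fun i => x * b i) => [i|].
  exact: subringM.
by rewrite mulr_sumr; apply: eq_bigr => i _; rewrite mulrA.
Qed.

Lemma span_ideal_sum A (J : Type) (r : seq J) (P : pred J) (f : J -> F) :
  is_subring A -> (forall j, P j -> span_ideal A (f j)) ->
  span_ideal A (\sum_(j <- r | P j) f j).
Proof.
move=> ringA fI; apply: (big_ind (span_ideal A)) => //; last first.
  by move=> x y; exact: span_idealD.
exists (fun=> 0) => [i|]; first exact: subring0.
by rewrite big1 // => i _; rewrite mul0r.
Qed.

Lemma span_ideal_sub A : is_subring A -> (forall i, A (w i)) ->
  span_ideal A `<=` A.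
Proof. by move=> ringA Aw x [a Aa ->]; apply: subring_sum => // i _; exact: subringM. Qed.

(* If 1 is a polynomial both in x and in 1/x with coefficients in the ideal
   spanned by w, multiplying the relation of higher degree by 1 minus the
   constant term of the other one lowers its degree. *)
Lemma no_two_sided_relation A n (P Q : {poly F}) x y : is_subring A ->
  (forall i, A (w i)) -> ~ span_ideal A 1 -> x * y = 1 ->
  (size P + size Q <= n)%N ->
  (forall i, span_ideal A P`_i) -> (forall i, span_ideal A Q`_i) ->
  P.[x] = 1 -> Q.[y] = 1 -> False.
Proof.
move=> ringA Aw A1; elim: n P Q x y => [|n IH] P Q x y xy sPQ PI QI Px Qy.
  move: sPQ; rewrite leqn0 addn_eq0 !size_poly_eq0 => /andP[/eqP P0 _].
  by move/eqP: Px; rewrite P0 horner0 eq_sym oner_eq0.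
wlog sQP : P Q x y xy sPQ PI QI Px Qy / (size Q <= size P)%N.
  move=> wl; have [|/ltnW] := leqP (size Q) (size P); first exact: (wl P Q x y).
  by apply: (wl Q P y x) => //; rewrite ?[y * x]mulrC // addnC.
have [sQ|sQ] := leqP (size Q) 1.
  by apply: A1; move: Qy; rewrite [Q]size1_polyC // hornerC => <-; exact: QI.
have sub := span_ideal_sub ringA Aw.
have nP : ((size P).-1.+1 = size P)%N by rewrite prednK // (leq_trans _ sQP) // ltnW.
have nQ : ((size Q).-1.+1 = size Q)%N by rewrite prednK // ltnW.
pose d := (size P).-1; pose an := P`_d; pose b0 := Q`_0.
have dQ : ((size Q).-1 <= d)%N by rewrite -ltnS nP nQ.
(* As y = 1/x, the relation for Q says that 1 - [b0] is the sum of the b_j y^j with j > 0. The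
   leading term of P times 1 - [b0] thus becomes the last sum, of degree below d; [dQ] ensures that
   the exponents are not truncated. *)
pose P' := b0%:P + \sum_(i < d) (((1 - b0) * P`_i) *: 'X^i)
  + \sum_(j < (size Q).-1) ((an * Q`_j.+1) *: 'X^(d - j.+1)).
have sP' : (size P' <= d)%N.
  have d0 : (0 < d)%N by rewrite -ltnS nP (leq_trans sQ).
  rewrite (leq_trans (size_polyD _ _)) // geq_max; apply/andP; split.
    rewrite (leq_trans (size_polyD _ _)) // geq_max; apply/andP; split.
      by rewrite (leq_trans (size_polyC_leq1 _)).
    apply: (leq_trans (size_sum _ _ _)); apply/bigmax_leqP => i _.
    by rewrite (leq_trans (size_scale_leq _ _)) // size_polyXn.
  apply: (leq_trans (size_sum _ _ _)); apply/bigmax_leqP => i _.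
  by rewrite (leq_trans (size_scale_leq _ _)) // size_polyXn ltn_subrL.
apply: (IH P' Q x y) => //.
- rewrite -ltnS (leq_trans _ sPQ) // ltn_add2r -nP ltnS //.
- move=> i; rewrite /P' !coefD !coef_sum.
  apply: span_idealD => //; first apply: span_idealD => //.
  + rewrite coefC; case: eqP => _; [exact: QI|rewrite -(mul0r b0)].
    by apply: span_idealM => //; [exact: subring0|exact: QI].
  + apply: span_ideal_sum => // j _; rewrite coefZ coefXn mulrC.
    apply: span_idealM => //.
      by case: eqP => _; [exact: subring1|exact: subring0].
    apply: span_idealM => //; apply: subringB => //; first exact: subring1.
    exact/sub/QI.
  + apply: span_ideal_sum => // j _; rewrite coefZ coefXn mulrC.
    apply: span_idealM => //.
      by case: eqP => _; [exact: subring1|exact: subring0].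
    by apply: span_idealM => //; exact/sub/PI.
- move: Px; rewrite horner_coef -nP big_ord_recr /= -/d -/an => Px.
  move: Qy; rewrite horner_coef -nQ big_ord_recl /= expr0 mulr1 -/b0 => Qy.
  rewrite /P' !hornerD hornerC !horner_sum.
  under eq_bigr do rewrite hornerZ hornerXn -mulrA.
  rewrite -mulr_sumr -[\sum_(i < d) _](addrK (an * x ^+ d)) Px.
  have -> : \sum_(j < (size Q).-1) ((an * Q`_j.+1) *: 'X^(d - j.+1)).[x]
      = an * x ^+ d * (1 - b0).
    rewrite -Qy addrC addrA addNr add0r mulr_sumr; apply: eq_bigr => j _.
    rewrite hornerZ hornerXn /bump leq0n add1n.
    have jd : (j.+1 <= d)%N by rewrite (leq_trans _ dQ).
    rewrite -{2}(subnK jd) exprD -!mulrA; congr (_ * _).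
    rewrite [LHS]mulrC; congr (_ * _); rewrite mulrCA -exprMn xy expr1n mulr1 //.
  by ring.
Qed.

(** Zorn's lemma on the rings above B in which [w] still spans a proper ideal. If neither x nor 1/x
    lies in a maximal such ring, adjoining either one puts 1 into the span, and the two relations
    contradict [no_two_sided_relation]. *)
Lemma chevalley_extension (B : set F) : is_subring B -> (forall i, B (w i)) ->
  ~ span_ideal B 1 ->
  exists O : set F, [/\ is_valuation_ring O, B `<=` O &
    forall i, maximal_ideal O (w i)].
Proof.
move=> ringB Bw B1.
pose good A := [/\ is_subring A, B `<=` A & ~ span_ideal A 1].
(* The union with B makes the predicate hold for the empty chain as well, whose union is empty. *)
have [|A [goodA maxA]] := @Zorn_bigcup F (fun A => good (A `|` B)).
  move=> C Cgood Ctot.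
  have [->|/set0P[A0 CA0]] := eqVneq C set0.
    by rewrite bigcup_set0 set0U; split.
  have dir x y : (\bigcup_(A in C) A `|` B) x -> (\bigcup_(A in C) A `|` B) y ->
      exists A, [/\ C A, (A `|` B) x & (A `|` B) y].
    move=> [[A1 CA1 A1x]|Bx] [[A2 CA2 A2y]|By].
    - have [s|s] := Ctot _ _ CA1 CA2.
        by exists A2; split => //; left => //; exact: s.
      by exists A1; split => //; left => //; exact: s.
    - by exists A1; split => //; [left|right].
    - by exists A2; split => //; [right|left].
    - by exists A0; split => //; right.
  (* A relation expressing 1 has finitely many coefficients, so they all lie in a single member of
     the chain. *)
  have dirs (f : I -> F) : (forall i, (\bigcup_(A in C) A `|` B) (f i)) ->
      exists2 A, C A & forall i, (A `|` B) (f i).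
    move=> Cf.
    suff [A CA Af] : exists2 A, C A & forall i, i \in enum I -> (A `|` B) (f i).
      by exists A => // i; apply: Af; rewrite mem_enum.
    elim: (enum I) => [|i s [A CA Af]]; first by exists A0.
    have [[A1 CA1 A1i]|Bi] := Cf i; last first.
      by exists A => // j; rewrite inE => /orP[/eqP ->|/Af//]; right.
    have [s12|s12] := Ctot _ _ CA CA1.
      exists A1 => // j; rewrite inE => /orP[/eqP ->|/Af[Aj|]]; [by left| |by right].
      by left; exact: s12.
    exists A => // j; rewrite inE => /orP[/eqP ->|/Af//]; left; exact: s12.
  split.
  - split; first by right; exact: subring1.
    + move=> x y /dir h /h [A [CA Ax Ay]].
      have [rA _ _] := Cgood _ CA.
      by have [?|?] := subringB rA Ax Ay; [left; exists A|right].
    + move=> x y /dir h /h [A [CA Ax Ay]].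
      have [rA _ _] := Cgood _ CA.
      by have [?|?] := subringM rA Ax Ay; [left; exists A|right].
  - by move=> x Bx; right.
  - move=> [a /dirs[A CA Aa] E]; have [_ _] := Cgood _ CA; apply.
    by exists a.
set O := A `|` B in goodA; case: goodA => ringO BO O1.
have maxO O' : good O' -> O `<=` O' -> O' `<=` O.
  move=> gO' sOO' x O'x; apply: contrapT => nOx.
  apply: (maxA O'); last first.
    suff -> : O' `|` B = O' by [].
    by rewrite setUidl //; case: gO'.
  split=> [y Ay|h]; first by apply: sOO'; left.
  by apply: nOx; left; exact: h.
have Ow i : O (w i) by exact: BO.
exists O.
(* By maximality 1 is in the span of [w] over O[x]; collecting the powers of x gives coefficients in
   the span over O. *)
have rel x : ~ O x -> exists2 P : {poly F}, (forall i, span_ideal O P`_i) & P.[x] = 1.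
  move=> nOx.
  pose O' := [set f | exists2 p : {poly F}, (forall i, O p`_i) & f = p.[x]].
  have OO' : O `<=` O'.
    move=> y Oy; exists y%:P => [i|]; last by rewrite hornerC.
    by rewrite coefC; case: eqP => _ //; exact: subring0.
  have ringO' : is_subring O'.
    split; first by apply: OO'; exact: subring1.
    - move=> _ _ [p Op ->] [q Oq ->]; exists (p - q) => [i|].
        by rewrite coefB; exact: subringB.
      by rewrite hornerD hornerN.
    - move=> _ _ [p Op ->] [q Oq ->]; exists (p * q) => [i|].
        by rewrite coefM; apply: subring_sum => // j _; exact: subringM.
      by rewrite hornerM.
  have [|h] := pselect (span_ideal O' 1); last first.
    case: nOx; apply: (maxO O') => //.
      by split => // y By; apply: OO'; exact: BO.
    exists 'X; last by rewrite hornerX.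
    by move=> i; rewrite coefX; case: eqP => _; [exact: subring1|exact: subring0].
  move=> [a /(_ _)/cid2 h E].
  exists (\sum_i (w i) *: s2val (h i)) => [k|].
    rewrite coef_sum; exists (fun i => (s2val (h i))`_k) => [i|].
      exact: (s2valP (h i)).
    by apply: eq_bigr => i _; rewrite coefZ mulrC.
  rewrite horner_sum E; apply: eq_bigr => i _.
  by rewrite hornerZ -(s2valP' (h i)) mulrC.
split => //; last first.
  move=> i; have [->|wi0] := eqVneq (w i) 0; [by left|right => Owi].
  apply: O1; exists (fun j => if j == i then (w i)^-1 else 0) => [j|].
    by case: eqP => _ //; exact: subring0.
  rewrite (bigD1 i) //= eqxx mulVf // big1 ?addr0 // => j /negPf ->.
  by rewrite mul0r.
split=> // x; have [|nOx] := pselect (O x); [by left|right].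
apply: contrapT => nOxV.
have x0 : x != 0 by apply/eqP => x0; apply: nOx; rewrite x0; exact: subring0.
have [P PI Px] := rel _ nOx; have [Q QI Qx] := rel _ nOxV.
by apply: (no_two_sided_relation ringO Ow O1 (divff x0) (leqnn _) PI QI Px Qx).
Qed.

End ChevalleyExtension.

(** * Cartan decomposition over a valuation ring *)

Section ValuationRing.
Variables (F : fieldType) (O : set F).
Hypothesis valO : is_valuation_ring O.
Let ringO : is_subring O := valO.1.

Lemma maximal_ideal_sub x : maximal_ideal O x -> O x.
Proof. by case=> [->|nO]; [exact: subring0|case: (valO.2 x)]. Qed.

Lemma maximal_idealMl a x :
  O a -> maximal_ideal O x -> maximal_ideal O (a * x).
Proof.
move=> Oa mx; have [->|ax0] := eqVneq (a * x) 0; first by left.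
case: mx => [x0|nOx]; first by move: ax0; rewrite x0 mulr0 eqxx.
right=> h; apply: nOx; have -> : x^-1 = a * (a * x)^-1.
  move: ax0; rewrite mulf_eq0 negb_or => /andP[a0 x0].
  by rewrite invfM mulrA divff // mul1r.
exact: subringM.
Qed.

Lemma maximal_ideal1 : ~ maximal_ideal O 1.
Proof.
case=> [/eqP|]; first by rewrite oner_eq0.
by rewrite invr1; apply; exact: subring1.
Qed.

Lemma maximal_ideal_unit x : O x -> ~ maximal_ideal O x -> x != 0 /\ O x^-1.
Proof.
move=> Ox nm; split; first by apply/eqP => x0; apply: nm; left.
by apply: contrapT => h; apply: nm; right.
Qed.

Lemma valuation_ring_total x y :
  (exists2 c, O c & x = c * y) \/ (exists2 c, O c & y = c * x).
Proof.
have [->|y0] := eqVneq y 0.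
  by right; exists 0; [exact: subring0|rewrite mul0r].
have [->|x0] := eqVneq x 0.
  by left; exists 0; [exact: subring0|rewrite mul0r].
have [h|h] := valO.2 (x / y); [left; exists (x / y)|right; exists (y / x)] => //.
- by rewrite divfK.
- by rewrite -invf_div.
- by rewrite divfK.
Qed.

Lemma maximal_idealD x y :
  maximal_ideal O x -> maximal_ideal O y -> maximal_ideal O (x + y).
Proof.
move=> mx my; have [[c Oc ->]|[c Oc ->]] := valuation_ring_total x y.
  rewrite -{2}[y]mul1r -mulrDl; apply: maximal_idealMl => //.
  by apply: subringD => //; exact: subring1.
rewrite -{1}[x]mul1r -mulrDl; apply: maximal_idealMl => //.
by apply: subringD => //; exact: subring1.
Qed.

Lemma maximal_ideal_sum (I : Type) (r : seq I) (P : pred I) (f : I -> F) :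
  (forall i, P i -> maximal_ideal O (f i)) ->
  maximal_ideal O (\sum_(i <- r | P i) f i).
Proof.
by move=> mf; apply: big_ind => //; [left|exact: maximal_idealD].
Qed.

Lemma valuation_ring_generator (I : eqType) (s : seq I) (f : I -> F) (i0 : I) :
  exists j, [/\ j \in i0 :: s &
    forall i, i \in i0 :: s -> exists2 c, O c & f i = c * f j].
Proof.
elim: s => [|i1 s [j [js jm]]].
  exists i0; split; first exact: mem_head.
  by move=> i; rewrite inE => /eqP ->; exists 1; [exact: subring1|rewrite mul1r].
have sub i : i \in [:: i0, i1 & s] -> i = i1 \/ i \in i0 :: s.
  by rewrite !inE => /or3P[/eqP->|/eqP->|->]; [right; rewrite eqxx|left|right; rewrite orbT].
have [[c Oc E]|[c Oc E]] := valuation_ring_total (f i1) (f j).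
  exists j; split; first by move: js; rewrite !inE => /orP[->//|->]; rewrite !orbT.
  by move=> i /sub[->|/jm//]; exists c.
exists i1; split; first by rewrite !inE eqxx orbT.
move=> i /sub[->|/jm[c' Oc' ->]].
  by exists 1; [exact: subring1|rewrite mul1r].
by exists (c' * c); [exact: subringM|rewrite E mulrA].
Qed.

Definition mx_over m n (A : 'M[F]_(m, n)) : Prop := forall i j, O (A i j).

Lemma mx_overM m n p (A : 'M[F]_(m, n)) (B : 'M[F]_(n, p)) :
  mx_over A -> mx_over B -> mx_over (A *m B).
Proof.
by move=> OA OB i j; rewrite mxE; apply: subring_sum => // k _; exact: subringM.
Qed.

Lemma mx_over_scalar n a : O a -> mx_over (a%:M : 'M[F]_n).
Proof.
move=> Oa i j; rewrite mxE; case: (i == j); rewrite ?mulr1n ?mulr0n //.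
exact: subring0.
Qed.

Lemma mx_over0 m n : mx_over (0 : 'M[F]_(m, n)).
Proof. by move=> i j; rewrite mxE; exact: subring0. Qed.

Lemma mx_over_perm n (s : 'S_n) : mx_over (perm_mx s : 'M[F]_n).
Proof.
move=> i j; rewrite !mxE; case: (_ == _); [exact: subring1|exact: subring0].
Qed.

Lemma mx_over_block m n (A : 'M[F]_m) B C (D : 'M[F]_n) :
  mx_over A -> mx_over B -> mx_over C -> mx_over D ->
  mx_over (block_mx A B C D).
Proof.
move=> OA OB OC OD i j; rewrite !mxE; case: fintype.split => i'; rewrite mxE;
  case: fintype.split => j' //.
Qed.

Definition GL_over n (u : 'M[F]_n) : Prop :=
  exists u', [/\ mx_over u, mx_over u', u *m u' = 1%:M & u' *m u = 1%:M].

Lemma GL_over1 n : GL_over (1%:M : 'M[F]_n).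
Proof.
by exists 1%:M; split; rewrite ?mulmx1 //; apply: mx_over_scalar; exact: subring1.
Qed.

Lemma GL_overM n (u v : 'M[F]_n) : GL_over u -> GL_over v -> GL_over (u *m v).
Proof.
move=> [u' [Ou Ou' uu' u'u]] [v' [Ov Ov' vv' v'v]]; exists (v' *m u').
split; try exact: mx_overM.
- by rewrite mulmxA -(mulmxA u) vv' mulmx1.
- by rewrite mulmxA -(mulmxA v') u'u mulmx1.
Qed.

Lemma GL_over_tperm n (i j : 'I_n) : GL_over (tperm_mx i j : 'M[F]_n).
Proof.
exists (tperm_mx i j); split; try exact: mx_over_perm;
by rewrite /tperm_mx -perm_mxM tperm2 perm_mx1.
Qed.

Lemma GL_over_lower n (c : 'M[F]_(n, 1)) :
  mx_over c -> GL_over (block_mx 1%:M 0 c 1%:M : 'M[F]_(1 + n)).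
Proof.
move=> Oc; have Oc' : mx_over (- c) by move=> i j; rewrite mxE; exact: subringN.
have O1 k : mx_over (1%:M : 'M[F]_k) by apply: mx_over_scalar; exact: subring1.
exists (block_mx 1%:M 0 (- c) 1%:M); split; try (apply: mx_over_block => //; exact: mx_over0);
by rewrite mulmx_block !mulmx1 !mul1mx !mul0mx !mulmx0 !addr0 !add0r ?subrr ?addNr -scalar_mx_block.
Qed.

Lemma GL_over_upper n (c : 'M[F]_(1, n)) :
  mx_over c -> GL_over (block_mx 1%:M c 0 1%:M : 'M[F]_(1 + n)).
Proof.
move=> Oc; have Oc' : mx_over (- c) by move=> i j; rewrite mxE; exact: subringN.
have O1 k : mx_over (1%:M : 'M[F]_k) by apply: mx_over_scalar; exact: subring1.
exists (block_mx 1%:M (- c) 0 1%:M); split; try (apply: mx_over_block => //; exact: mx_over0);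
by rewrite mulmx_block !mulmx1 !mul1mx !mul0mx !mulmx0 !addr0 !add0r ?subrr ?addNr -scalar_mx_block.
Qed.

Lemma GL_over_block n (u : 'M[F]_n) :
  GL_over u -> GL_over (block_mx 1%:M 0 0 u : 'M[F]_(1 + n)).
Proof.
move=> [u' [Ou Ou' uu' u'u]]; exists (block_mx 1%:M 0 0 u').
have O1 : mx_over (1%:M : 'M[F]_1) by apply: mx_over_scalar; exact: subring1.
split; try (apply: mx_over_block => //; exact: mx_over0);
by rewrite mulmx_block !mulmx1 !mul0mx !mulmx0 !addr0 !add0r ?uu' ?u'u -scalar_mx_block.
Qed.

Definition cartan_decomposable n (g : 'M[F]_n) : Prop :=
  exists k d h, [/\ GL_over k, GL_over h & g = k *m diag_mx d *m h].

Lemma cartan_decomposable_GL n (u g v : 'M[F]_n) :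
  GL_over u -> GL_over v -> cartan_decomposable g ->
  cartan_decomposable (u *m g *m v).
Proof.
move=> gu gv [k [d [h [gk gh ->]]]]; exists (u *m k), d, (h *m v).
by split; rewrite ?mulmxA //; exact: GL_overM.
Qed.

(** Gaussian elimination with full pivoting. Divisibility in O is total, so some entry divides all
    the others; once it is in the corner, the multipliers that clear its row and column lie in O,
    and induction treats the Schur complement. *)
Lemma cartan_decomposition n (g : 'M[F]_n) : cartan_decomposable g.
Proof.
elim: n g => [|n IH] g.
  by exists 1%:M, 0, 1%:M; split; [exact: GL_over1|exact: GL_over1|by apply/matrixP => -[]].
suff corner (f : 'M[F]_n.+1) :
    (forall i j, exists2 c, O c & f i j = c * f ord0 ord0) ->
    cartan_decomposable f.
  have [[i0 j0] [_ max0]] := valuation_ring_generator (enum {: 'I_n.+1 * 'I_n.+1})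
    (fun p => g p.1 p.2) (ord0, ord0).
  have {}max0 i j : exists2 c, O c & g i j = c * g i0 j0.
    by apply: (max0 (i, j)); rewrite inE mem_enum orbT.
  pose g' := tperm_mx i0 ord0 *m g *m tperm_mx j0 ord0.
  have -> : g = tperm_mx i0 ord0 *m g' *m tperm_mx j0 ord0.
    have pp k : tperm_mx k ord0 *m tperm_mx k ord0 = 1%:M :> 'M[F]_n.+1.
      by rewrite /tperm_mx -perm_mxM tperm2 perm_mx1.
    by rewrite /g' !mulmxA pp mul1mx -mulmxA pp mulmx1.
  apply: cartan_decomposable_GL; [exact: GL_over_tperm|exact: GL_over_tperm|].
  have g'E i j : g' i j = g (tperm i0 ord0 i) (tperm j0 ord0 j).
    by rewrite /g' -xrowE -xcolE !mxE.
  apply: corner => i j.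
    by rewrite !g'E !tpermR; exact: max0.
move: f => {}g max0.
have [a0|a0] := eqVneq (g ord0 ord0) 0.
  exists 1%:M, 0, 1%:M; split; try exact: GL_over1.
  apply/matrixP => i j; have [c _ ->] := max0 i j.
  by rewrite a0 mulr0 mul1mx mulmx1 !mxE mul0rn.
have Oq i j : O (g i j / g ord0 ord0).
  by have [c Oc ->] := max0 i j; rewrite mulfK.
move: g max0 a0 Oq; rewrite -[n.+1]/(1 + n)%N => g max0.
set a := g ord0 ord0 => a0 Oq.
pose r := ursubmx g; pose c := dlsubmx g; pose M := drsubmx g.
have gE : g = block_mx a%:M r c M.
  rewrite -[g in LHS]submxK; congr block_mx.
  apply/matrixP => i j; rewrite !ord1 !mxE eqxx mulr1n /a.
  by congr (g _ _); apply: val_inj.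
have -> : g = block_mx 1%:M 0 (a^-1 *: c) 1%:M
    *m block_mx a%:M 0 0 (M - a^-1 *: (c *m r))
    *m block_mx 1%:M (a^-1 *: r) 0 1%:M.
  rewrite !mulmx_block !mulmx1 !mul1mx !mul0mx !mulmx0 !addr0 !add0r {1}gE.
  rewrite !mul_mx_scalar !mul_scalar_mx ?scale1r.
  rewrite !scalerA divff // !scale1r -scalemxAr; congr block_mx.
  by rewrite addrC subrK.
apply: cartan_decomposable_GL.
- by apply: GL_over_lower => i j; rewrite !mxE mulrC; exact: Oq.
- by apply: GL_over_upper => i j; rewrite !mxE mulrC; exact: Oq.
have [k [d [h [gk gh ->]]]] := IH (M - a^-1 *: (c *m r)).
exists (block_mx 1%:M 0 0 k), (row_mx a%:M d), (block_mx 1%:M 0 0 h).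
split; try exact: GL_over_block.
rewrite diag_mx_row !mulmx_block !mulmx1 !mul1mx !mul0mx !mulmx0 !addr0 !add0r.
rewrite ?mulmx0 ?mul0mx; congr block_mx.
by apply/matrixP => i j; rewrite !ord1 !mxE.
Qed.

End ValuationRing.

(** * Fourier-Motzkin elimination *)

Lemma strictly_below (R : realFieldType) (lo : seq R) u :
  (forall x, x \in lo -> x < u) ->
  exists2 c, c < u & forall x, x \in lo -> x < c.
Proof.
elim: lo => [_|x lo IH lou]; first by exists (u - 1); rewrite // ltrBlDr ltrDl.
have [y ylo|c cu loc] := IH; first by apply: lou; rewrite inE ylo orbT.
have xu : x < u by apply: lou; exact: mem_head.
exists (Num.max c ((x + u) / 2)); first by rewrite gt_max cu /=; lra.
move=> y; rewrite inE lt_max => /orP[/eqP->|/loc ->//].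
by apply/orP; right; lra.
Qed.

Lemma between_seqs (R : realFieldType) (lo up : seq R) :
  (forall x y, x \in lo -> y \in up -> x < y) ->
  exists c, (forall x, x \in lo -> x < c) /\ (forall y, y \in up -> c < y).
Proof.
elim: up => [_|u up IH sep].
  elim: lo => [|x lo [c [loc _]]]; first by exists 0.
  exists (Num.max c (x + 1)); split => // y; rewrite inE lt_max.
  by move=> /orP[/eqP->|/loc->//]; rewrite ltrDl ltr01 orbT.
have [x y xlo yup|c [c1 c2]] := IH; first by apply: sep; rewrite // inE yup orbT.
have [cu|uc] := ltP c u.
  by exists c; split => // y; rewrite inE => /orP[/eqP->|/c2].
have [x xlo|d du lod] := @strictly_below _ lo u.
  by apply: sep => //; exact: mem_head.
exists d; split=> // y; rewrite inE => /orP[/eqP-> //|/c2]; apply: lt_trans.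
exact: lt_le_trans uc.
Qed.

Section FourierMotzkin.
Variables (R : realFieldType) (I : finType) (Pos : set {ffun I -> int}).
Hypothesis Pos0 : ~ Pos 0.
Hypothesis PosD : forall a b, Pos a -> Pos b -> Pos (a + b).

Lemma PosMn a n : (0 < n)%N -> Pos a -> Pos (a *+ n).
Proof.
case: n => // n _ Pa; elim: n => [|n IH]; first by rewrite mulr1n.
by rewrite mulrS; exact: PosD.
Qed.

Definition pairing (y : I -> R) (a : {ffun I -> int}) : R :=
  \sum_i y i * (a i)%:~R.

Lemma pairingD y a b : pairing y (a + b) = pairing y a + pairing y b.
Proof.
by rewrite -big_split /=; apply: eq_bigr => i _; rewrite ffunE intrD mulrDr.
Qed.

Lemma pairingMn y a n : pairing y (a *+ n) = pairing y a *+ n.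
Proof.
elim: n => [|n IH]; last by rewrite !mulrS pairingD IH.
by rewrite /pairing big1 // => i _; rewrite ffunE mulr0.
Qed.

Lemma pairing_shift y i0 c a :
  pairing (fun i => y i + (if i == i0 then c else 0)) a
  = pairing y a + c * (a i0)%:~R.
Proof.
rewrite /pairing; under eq_bigr do rewrite mulrDl.
rewrite big_split /=; congr (_ + _); rewrite (bigD1 i0) //= eqxx.
by rewrite big1 ?addr0 // => i /negPf ->; rewrite mul0r.
Qed.

(** Induction on the coordinates in which the vectors may be nonzero. Cancelling [i0] between a
    vector positive there and one negative there stays in [Pos], and positivity of [y] on these
    combinations says that every lower bound for the correction at [i0] is below every upper bound.
    With no coordinate left, a vector of the list would be 0, which is not in [Pos]. *)
Lemma positive_functional (l : seq {ffun I -> int}) :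
  (forall a, a \in l -> Pos a) ->
  exists y : I -> R, forall a, a \in l -> 0 < pairing y a.
Proof.
move=> lPos.
suff: forall (s : seq I) (l : seq {ffun I -> int}),
    (forall a, a \in l -> Pos a /\ forall i, i \notin s -> a i = 0) ->
    exists y : I -> R, forall a, a \in l -> 0 < pairing y a.
  by move=> /(_ (enum I) l); apply=> a /lPos Pa; split=> // i; rewrite mem_enum.
elim=> [|i0 s IH] {lPos}l lPos.
  exists (fun=> 0) => a /lPos[Pa a0]; case: Pos0.
  suff <- : a = 0 by [].
  by apply/ffunP => i; rewrite ffunE a0.
pose l0 := [seq a : {ffun I -> int} <- l | a i0 == 0].
pose lp := [seq a : {ffun I -> int} <- l | 0 < a i0].
pose ln := [seq a : {ffun I -> int} <- l | a i0 < 0].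
pose comb (a b : {ffun I -> int}) := a *+ absz (b i0) + b *+ absz (a i0).
have [y yP] : exists y : I -> R, forall a,
    a \in l0 ++ [seq comb a b | a <- lp, b <- ln] -> 0 < pairing y a.
  apply: IH => c; rewrite mem_cat => /orP[|/allpairsP[[a b] /= [+ + ->]]].
    rewrite mem_filter => /andP[/eqP c0 /lPos[Pc cs]]; split => // i is_.
    have [->//|ii0] := eqVneq i i0; apply: cs.
    by rewrite inE negb_or ii0.
  rewrite !mem_filter => /andP[a0 /lPos[Pa as_]] /andP[b0 /lPos[Pb bs]].
  split; first by apply: PosD; apply: PosMn => //; rewrite absz_gt0 ?(gt_eqF a0) ?(lt_eqF b0).
  move=> i is_; rewrite !ffunE !ffunMnE; have [->|ii0] := eqVneq i i0.
    rewrite -(mulr_natr (a i0)) -(mulr_natr (b i0)) !natz (gtz0_abs a0) (ltz0_abs b0).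
    by rewrite mulrN mulrC addNr.
  have is' : i \notin i0 :: s by rewrite inE negb_or ii0.
  by rewrite (as_ _ is') (bs _ is') !mul0rn addr0.
have [c [c1 c2]] : exists c : R,
    (forall x, x \in [seq - (pairing y a / (a i0)%:~R) | a : {ffun I -> int} <- lp] -> x < c) /\
    (forall x, x \in [seq - (pairing y b / (b i0)%:~R) | b : {ffun I -> int} <- ln] -> c < x).
  apply: between_seqs => _ _ /mapP[a alp ->] /mapP[b bln ->].
  have : 0 < pairing y (comb a b).
    by apply: yP; rewrite mem_cat; apply/orP; right; apply/allpairsP; exists (a, b).
  move: alp bln; rewrite !mem_filter => /andP[a0 _] /andP[b0 _].
  rewrite pairingD !pairingMn -(mulr_natr (pairing y a)) -(mulr_natr (pairing y b)).
  rewrite !natr_absz (gtr0_norm a0) (ltr0_norm b0).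
  rewrite rmorphN /=.
  have a0' : 0 < (a i0)%:~R :> R by rewrite ltr0z.
  have b0' : (b i0)%:~R < 0 :> R by rewrite ltrz0.
  rewrite ltrN2 ltr_ndivrMr // mulrAC ltr_pdivrMr //.
  by rewrite mulrN; lra.
exists (fun i => y i + (if i == i0 then c else 0)) => a al.
rewrite pairing_shift; case: (ltgtP (a i0) 0) => a0.
- have b0' : (a i0)%:~R < 0 :> R by rewrite ltrz0.
  have : c < - (pairing y a / (a i0)%:~R).
    by apply: c2; apply/mapP; exists a; rewrite // mem_filter a0.
  by rewrite ltrNr ltr_ndivrMr // mulNr; lra.
- have a0' : 0 < (a i0)%:~R :> R by rewrite ltr0z.
  have : - (pairing y a / (a i0)%:~R) < c.
    by apply: c1; apply/mapP; exists a; rewrite // mem_filter a0.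
  by rewrite ltrNl ltr_pdivlMr // mulNr; lra.
- rewrite a0 mulr0 addr0; apply: yP.
  by rewrite mem_cat mem_filter a0 eqxx al.
Qed.

End FourierMotzkin.

(** * Destabilizing weights *)

Lemma sum_triple (R : comNzRingType) (I J K : finType) (f : I -> R) (g : J -> R)
    (h : K -> R) :
  \sum_(p : I * J * K) f p.1.1 * g p.1.2 * h p.2
  = (\sum_i f i) * (\sum_j g j) * (\sum_k h k).
Proof.
rewrite big_distrlr /= pair_big big_distrlr pair_big /=.
by apply: eq_bigr => -[[i j] k].
Qed.

Section TensorAction.
Variables (F : fieldType) (m1 m2 m3 : nat).
Implicit Type T : tensor F m1 m2 m3.

Lemma tensor_actE g1 g2 g3 T x :
  tensor_act g1 g2 g3 T x =
  \sum_p g1 x.1.1 p.1.1 * g2 x.1.2 p.1.2 * g3 x.2 p.2 * T p.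
Proof.
rewrite ffunE pair_big pair_big /=.
by apply: eq_bigr => -[[i j] k].
Qed.

Lemma tensor_act_comp g1 g2 g3 h1 h2 h3 T :
  tensor_act g1 g2 g3 (tensor_act h1 h2 h3 T)
  = tensor_act (g1 *m h1) (g2 *m h2) (g3 *m h3) T.
Proof.
apply/ffunP => x; rewrite !tensor_actE.
under eq_bigr do rewrite tensor_actE mulr_sumr.
rewrite exchange_big /=; apply: eq_bigr => q _.
rewrite !mxE -sum_triple mulr_suml; apply: eq_bigr => p _.
by ring.
Qed.

Lemma tensor_act1 T : tensor_act 1%:M 1%:M 1%:M T = T.
Proof.
apply/ffunP => x; rewrite tensor_actE (bigD1 x) //= !mxE !eqxx !mulr1n !mul1r.
rewrite big1 ?addr0 // => -[[i j] k].
case: x => -[i' j'] k' /=; rewrite !xpair_eqE !negb_and !mxE /=.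
rewrite (eq_sym i) (eq_sym j) (eq_sym k).
by move=> /orP[/orP[]|] /negPf ->; rewrite !(mulr0, mul0r, mulr0n).
Qed.

Lemma tensor_act_diag d1 d2 d3 T x :
  tensor_act (diag_mx d1) (diag_mx d2) (diag_mx d3) T x
  = d1 0 x.1.1 * d2 0 x.1.2 * d3 0 x.2 * T x.
Proof.
rewrite tensor_actE (bigD1 x) //= !mxE !eqxx !mulr1n.
rewrite big1 ?addr0 // => -[[i j] k].
case: x => -[i' j'] k' /=; rewrite !xpair_eqE !negb_and !mxE /=.
rewrite (eq_sym i) (eq_sym j) (eq_sym k).
by move=> /orP[/orP[]|] /negPf ->; rewrite !(mulr0, mul0r, mulr0n).
Qed.

End TensorAction.

(** * Values of localized functions at a point *)

Section FractionEvaluation.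
Variables (P : idomainType) (L : fieldType) (ev : {rmorphism P -> L}) (D : P).
Hypothesis ev1 : ev D = 1.

(** The element f of P[1/D] takes the value c at the point [ev], where D is 1. A relation avoids
    choosing a fraction num / D^e for f. *)
Definition evaluates (f : {fraction P}) (c : L) : Prop :=
  exists e num, f * FracField.tofrac D ^+ e = FracField.tofrac num /\ ev num = c.

Lemma evaluates_frac p : evaluates (FracField.tofrac p) (ev p).
Proof. by exists 0%N, p; rewrite expr0 mulr1. Qed.

Lemma evaluatesB f f' c c' : evaluates f c -> evaluates f' c' ->
  evaluates (f - f') (c - c').
Proof.
move=> [e [n [E <-]]] [e' [n' [E' <-]]].
exists (e + e')%N, (n * D ^+ e' - n' * D ^+ e).
rewrite !rmorphB !rmorphM !rmorphXn /= -E -E' ev1 !expr1n !mulr1.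
by split=> //; rewrite exprD; ring.
Qed.

Lemma evaluatesM f f' c c' : evaluates f c -> evaluates f' c' ->
  evaluates (f * f') (c * c').
Proof.
move=> [e [n [E <-]]] [e' [n' [E' <-]]].
exists (e + e')%N, (n * n').
by rewrite !rmorphM /= -E -E' exprD; split=> //; ring.
Qed.

Lemma evaluates_sum (K : finType) (f : K -> {fraction P}) (c : K -> L) :
  (forall k, evaluates (f k) (c k)) ->
  evaluates (\sum_k f k) (\sum_k c k).
Proof.
move=> fc; have e0 : evaluates 0 0.
  by have := evaluates_frac 0; rewrite !rmorph0.
apply: (big_ind2 evaluates) => // a b a' b' h h'.
rewrite -[a']opprK -[b']opprK -[- a']sub0r -[- b']sub0r.
by do 2!apply: evaluatesB => //.
Qed.

Lemma evaluates1 c : evaluates 1 c -> c = 1.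
Proof.
move=> [e [n [/eqP]]]; rewrite mul1r -rmorphXn tofrac_eq => /eqP <- <-.
by rewrite rmorphXn /= ev1 expr1n.
Qed.

End FractionEvaluation.

(* The valuation ring dominates a ring of functions on the orbit at the point
   0, and (g1, g2, g3) is the generic point of GL x GL x GL. The quotient by
   the determinants is the invariant form of "det = 1". *)
Section ValuativeCriterion.
Variables (L : fieldType) (m1 m2 m3 : nat) (T : tensor L m1 m2 m3).

Let J : finType := ('I_m1 * 'I_m1 + 'I_m2 * 'I_m2 + 'I_m3 * 'I_m3)%type.
Let N := #|{: J}|.
Let P : idomainType := mpoly N L.
Let F : fieldType := {fraction P}.
Let frac : {rmorphism P -> F} := @FracField.tofrac P.
Let I : finType := ('I_m1 * 'I_m2 * 'I_m3)%type.
Let phi : {rmorphism L -> F} := frac \o @mpolyC N L.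

Let X (j : J) : P := mpolyX L (mnm1 (enum_rank j)).
Let X1 : 'M[P]_m1 := \matrix_(i, j) X (inl (inl (i, j))).
Let X2 : 'M[P]_m2 := \matrix_(i, j) X (inl (inr (i, j))).
Let X3 : 'M[P]_m3 := \matrix_(i, j) X (inr (i, j)).
Let G1 := map_mx frac X1.
Let G2 := map_mx frac X2.
Let G3 := map_mx frac X3.

Let pt (g1 : 'M[L]_m1) (g2 : 'M[L]_m2) (g3 : 'M[L]_m3) (s : 'I_N) : L :=
  match enum_val s with
  | inl (inl p) => g1 p.1 p.2
  | inl (inr p) => g2 p.1 p.2
  | inr p => g3 p.1 p.2
  end.
Let ev g1 g2 g3 : {rmorphism P -> L} := meval (pt g1 g2 g3).

(** The exponents make D homogeneous of degree m1 m2 m3 in each of the three matrices, like the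
    power of a coordinate that it divides in [valuative_criterion]. *)
Let D : P := \det X1 ^+ (m2 * m3) * \det X2 ^+ (m1 * m3) * \det X3 ^+ (m1 * m2).

Let evX g1 g2 g3 :
  [/\ map_mx (ev g1 g2 g3) X1 = g1, map_mx (ev g1 g2 g3) X2 = g2 &
      map_mx (ev g1 g2 g3) X3 = g3].
Proof.
by split; apply/matrixP => i j; rewrite !mxE /ev /X /= mevalXU /pt enum_rankK.
Qed.

Let ev_det g1 g2 g3 :
  [/\ ev g1 g2 g3 (\det X1) = \det g1, ev g1 g2 g3 (\det X2) = \det g2 &
      ev g1 g2 g3 (\det X3) = \det g3].
Proof.
by have [e1 e2 e3] := evX g1 g2 g3; split; rewrite -det_map_mx ?e1 ?e2 ?e3.
Qed.

Let evD g1 g2 g3 : \det g1 = 1 -> \det g2 = 1 -> \det g3 = 1 ->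
  ev g1 g2 g3 D = 1.
Proof.
move=> d1 d2 d3; have [e1 e2 e3] := ev_det g1 g2 g3.
by rewrite !rmorphM !rmorphXn /= e1 e2 e3 d1 d2 d3 !expr1n !mulr1.
Qed.

Let detX_neq0 : [/\ \det X1 != 0, \det X2 != 0 & \det X3 != 0].
Proof.
have [e1 e2 e3] := ev_det 1%:M 1%:M 1%:M.
split; apply/eqP => d0.
- by move: e1; rewrite d0 rmorph0 det1 => /eqP; rewrite eq_sym oner_eq0.
- by move: e2; rewrite d0 rmorph0 det1 => /eqP; rewrite eq_sym oner_eq0.
- by move: e3; rewrite d0 rmorph0 det1 => /eqP; rewrite eq_sym oner_eq0.
Qed.

Let D_neq0 : frac D != 0.
Proof.
have [d1 d2 d3] := detX_neq0.
by rewrite tofrac_eq0 !mulf_neq0 // expf_neq0.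
Qed.

Let evaluates_coord g1 g2 g3 x e :
  evaluates (ev g1 g2 g3) D
    ((tensor_act G1 G2 G3 [ffun y => phi (T y)]) x ^+ e / frac D)
    ((tensor_act g1 g2 g3 T) x ^+ e).
Proof.
exists 1%N, ((\sum_p X1 x.1.1 p.1.1 * X2 x.1.2 p.1.2 * X3 x.2 p.2 *
  mpolyC N (T p)) ^+ e).
rewrite expr1 divfK // !rmorphXn /= !rmorph_sum !tensor_actE; split; congr (_ ^+ _).
  apply: eq_bigr => p _; rewrite !rmorphM /= !mxE !ffunE //.
apply: eq_bigr => p _; rewrite !rmorphM /=.
by rewrite !mxE /X !mevalXU /pt !enum_rankK mevalC.
Qed.

Lemma valuative_criterion :
  zariski_closure (SL_orbit T) 0 -> (0 < m1 * m2 * m3)%N ->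
  exists (F : fieldType) (phi : {rmorphism L -> F}) (O : set F)
    (g1 : 'M[F]_m1) (g2 : 'M[F]_m2) (g3 : 'M[F]_m3),
  [/\ is_valuation_ring O, forall c, O (phi c),
      [/\ \det g1 != 0, \det g2 != 0 & \det g3 != 0] &
      forall x, maximal_ideal O
        ((tensor_act g1 g2 g3 [ffun y => phi (T y)]) x ^+ (m1 * m2 * m3) /
         (\det g1 ^+ (m2 * m3) * \det g2 ^+ (m1 * m3) * \det g3 ^+ (m1 * m2)))].
Proof.
set M := (m1 * m2 * m3)%N => T0 M0.
pose w x : F := (tensor_act G1 G2 G3 [ffun y => phi (T y)]) x ^+ M / frac D.
pose at0 g1 g2 g3 := meval (fun i : 'I_#|{: I}| =>
  (tensor_act g1 g2 g3 T) (enum_val i)).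
(* The functions whose values on SL x SL x SL are polynomials in the coordinates of the translated
   tensor. *)
pose B := [set f : F | exists Q : mpoly #|{: I}| L, forall g1 g2 g3,
  \det g1 = 1 -> \det g2 = 1 -> \det g3 = 1 ->
  evaluates (ev g1 g2 g3) D f (at0 g1 g2 g3 Q)].
have BC c : B (phi c).
  exists (mpolyC _ c) => g1 g2 g3 d1 d2 d3.
  have := evaluates_frac (ev g1 g2 g3) D (mpolyC N c).
  by rewrite /at0 /ev /= !mevalC.
have ringB : is_subring B.
  split.
  - by rewrite -(rmorph1 phi); exact: BC.
  - move=> f f' [Q h] [Q' h']; exists (Q - Q') => g1 g2 g3 d1 d2 d3.
    rewrite /at0 mevalB; apply: (evaluatesB (evD d1 d2 d3)); [exact: h|exact: h'].
  - move=> f f' [Q h] [Q' h']; exists (Q * Q') => g1 g2 g3 d1 d2 d3.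
    rewrite /at0 mevalM; apply: evaluatesM; [exact: h|exact: h'].
have Bw x : B (w x).
  exists (mpolyX L (mnm1 (enum_rank x)) ^+ M) => g1 g2 g3 d1 d2 d3.
  rewrite /at0 rmorphXn /= mevalXU enum_rankK.
  exact: evaluates_coord.
have B1 : ~ span_ideal w B 1.
  move=> [a /(_ _)/cid Ba E].
  (* A relation expressing 1 over B turns into a polynomial that vanishes on the orbit but is -1 at
     the tensor 0. *)
  pose Q := \sum_x sval (Ba x) * mpolyX L (mnm1 (enum_rank x)) ^+ M - 1.
  have := T0 Q; have -> : meval (fun i => (0 : tensor L m1 m2 m3) (enum_val i)) Q = -1.
    rewrite /Q mevalB meval1 rmorph_sum big1 ?sub0r // => x _.
    by rewrite rmorphM rmorphXn /= mevalXU ffunE expr0n gtn_eqF // mulr0.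
  move=> h; suff /h/eqP : forall y, SL_orbit T y -> meval (fun i => y (enum_val i)) Q = 0.
    by rewrite oppr_eq0 oner_eq0.
  move=> _ [g1 [g2 [g3 [d1 d2 d3 ->]]]].
  rewrite /Q mevalB meval1; apply/eqP; rewrite subr_eq0; apply/eqP.
  apply: (evaluates1 (evD d1 d2 d3)); rewrite E rmorph_sum /=.
  apply: (evaluates_sum (evD d1 d2 d3)) => x.
  rewrite mevalM; apply: evaluatesM; first exact: (svalP (Ba x)).
  rewrite rmorphXn /= mevalXU enum_rankK; exact: evaluates_coord.
have [V [valV BV Vw]] := chevalley_extension ringB Bw B1.
have [n1 n2 n3] := detX_neq0.
exists F, phi, V, G1, G2, G3; split.
- exact: valV.
- by move=> c; apply/BV/BC.
- by rewrite !det_map_mx !tofrac_eq0.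
- move=> x; rewrite !det_map_mx -!rmorphXn -!rmorphM; exact: Vw.
Qed.

End ValuativeCriterion.

Section DestabilizingWeights.
Variables (F : fieldType) (O : set F).
Hypothesis valO : is_valuation_ring O.
Let ringO : is_subring O := valO.1.

Lemma tensor_act_over m1 m2 m3 (g1 : 'M[F]_m1) (g2 : 'M[F]_m2) (g3 : 'M[F]_m3)
    (T : tensor F m1 m2 m3) :
  mx_over O g1 -> mx_over O g2 -> mx_over O g3 -> (forall x, O (T x)) ->
  forall x, O (tensor_act g1 g2 g3 T x).
Proof.
move=> O1 O2 O3 OT x; rewrite tensor_actE; apply: subring_sum => // p _.
by do !apply: subringM => //.
Qed.

(** The elements whose M-th power over e lies in the maximal ideal form an O-module: of two of them
    one is a multiple of the other, hence so is their sum. *)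
Lemma maximal_ideal_power_sum (I : finType) (c f : I -> F) M (e : F) : (0 < M)%N ->
  (forall i, O (c i)) -> (forall i, maximal_ideal O (f i ^+ M / e)) ->
  maximal_ideal O ((\sum_i c i * f i) ^+ M / e).
Proof.
move=> M0 Oc mf.
pose S x := maximal_ideal O (x ^+ M / e).
have SM a x : O a -> S x -> S (a * x).
  move=> Oa Sx; rewrite /S exprMn -mulrA; apply: maximal_idealMl => //.
  exact: subringX.
suff : S (\sum_i c i * f i) by [].
apply: (big_ind S) => [|x y Sx Sy|i _]; last by apply: SM; [exact: Oc|exact: mf].
  by left; rewrite expr0n gtn_eqF // mul0r.
have [[a Oa ->]|[a Oa ->]] := valuation_ring_total valO x y.
  rewrite -{2}[y]mul1r -mulrDl; apply: SM => //.
  by apply: subringD => //; exact: subring1.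
rewrite -{1}[x]mul1r -mulrDl; apply: SM => //.
by apply: subringD => //; exact: subring1.
Qed.

Lemma det_over n (A : 'M[F]_n) : mx_over O A -> O (\det A).
Proof.
move=> OA; apply: subring_sum => // s _; apply: subringM => //.
  by apply: subringX => //; apply: subringN => //; exact: subring1.
by apply: subring_prod => // i _.
Qed.

Lemma det_cartan n (k h : 'M[F]_n) (d : 'rV[F]_n) :
  mx_over O k -> mx_over O h -> \det (k *m diag_mx d *m h) != 0 ->
  [/\ forall i, d 0 i != 0 &
      O (\det (k *m diag_mx d *m h) / \prod_i d 0 i)].
Proof.
move=> Ok Oh; rewrite !det_mulmx det_diag => nz.
have dnz : \prod_i d 0 i != 0.
  by move: nz; rewrite !mulf_eq0 !negb_or => /andP[/andP[_ ->]].
split=> [i|].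
  by move: dnz; rewrite prodf_seq_neq0 => /allP/(_ i); rewrite mem_index_enum; apply.
rewrite mulrAC mulfK //; apply: subringM => //; exact: det_over.
Qed.

Lemma prod_exprz_shift n (d : 'I_n -> F) (i0 : 'I_n) (M e : nat) :
  (forall i, d i != 0) ->
  \prod_i d i ^ ((if i == i0 then M else 0%N)%:Z - e%:Z) =
  d i0 ^+ M / (\prod_i d i) ^+ e.
Proof.
move=> d0.
under eq_bigr do rewrite expfzDr // -invr_expz -!exprnP.
rewrite prodf_div prodrXl (bigD1 i0) //= eqxx.
by rewrite big1 ?mulr1 // => i /negPf ->; rewrite expr0.
Qed.

(** The exponents of the monomials in the diagonal entries that lie in the maximal ideal form a
    semigroup without 0, so [positive_functional] replaces the valuations by real numbers. Dividing
    by the products of the entries becomes subtracting the mean. *)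
Lemma torus_weights (R : realFieldType) m1 m2 m3
    (d1 : 'I_m1 -> F) (d2 : 'I_m2 -> F) (d3 : 'I_m3 -> F)
    (S : seq ('I_m1 * 'I_m2 * 'I_m3)) (M := (m1 * m2 * m3)%N) :
  (forall i, d1 i != 0) -> (forall i, d2 i != 0) -> (forall i, d3 i != 0) ->
  (forall x, x \in S -> maximal_ideal O ((d1 x.1.1 * d2 x.1.2 * d3 x.2) ^+ M /
    ((\prod_i d1 i) ^+ (m2 * m3) * (\prod_i d2 i) ^+ (m1 * m3)
     * (\prod_i d3 i) ^+ (m1 * m2)))) ->
  exists (al : 'I_m1 -> R) (be : 'I_m2 -> R) (ga : 'I_m3 -> R),
    [/\ \sum_i al i = 0, \sum_i be i = 0, \sum_i ga i = 0 &
        forall x, x \in S -> 0 < al x.1.1 + be x.1.2 + ga x.2].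
Proof.
move=> d10 d20 d30 mS.
pose I : finType := ('I_m1 + 'I_m2 + 'I_m3)%type.
pose d (i : I) := match i with inl (inl i) => d1 i | inl (inr i) => d2 i | inr i => d3 i end.
have d0 i : d i != 0 by case: i => [[]|] i /=.
pose Pos := [set a : {ffun I -> int} | maximal_ideal O (\prod_i d i ^ a i)].
have Pos0 : ~ Pos 0.
  rewrite /Pos /= big1 ?expr0z; first exact: maximal_ideal1.
  by move=> i _; rewrite ffunE expr0z.
have PosD a b : Pos a -> Pos b -> Pos (a + b).
  rewrite /Pos /= => Pa Pb; under eq_bigr do rewrite ffunE expfzDr //.
  rewrite big_split /=; apply: maximal_idealMl => //; exact: maximal_ideal_sub.
pose vec (x : 'I_m1 * 'I_m2 * 'I_m3) : {ffun I -> int} := [ffun i : I => match i with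
  | inl (inl i) => (if i == x.1.1 then M else 0%N)%:Z - (m2 * m3)%N%:Z
  | inl (inr i) => (if i == x.1.2 then M else 0%N)%:Z - (m1 * m3)%N%:Z
  | inr i => (if i == x.2 then M else 0%N)%:Z - (m1 * m2)%N%:Z end].
have [|y yP] := @positive_functional R I Pos Pos0 PosD [seq vec x | x <- S].
  move=> _ /mapP[x xS ->]; rewrite /Pos /=.
  have := mS x xS; rewrite !big_sumType /=.
  under [in X in _ -> X]eq_bigr do rewrite ffunE.
  under [X in _ -> maximal_ideal O (_ * X * _)]eq_bigr do rewrite ffunE.
  under [X in _ -> maximal_ideal O (_ * X)]eq_bigr do rewrite ffunE.
  rewrite !prod_exprz_shift //; congr (maximal_ideal O _).
  by rewrite !exprMn !invfM; ring.
(* When n * e = M, this is M times the deviation of z i from the mean of z. *)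
pose shift n (z : 'I_n -> R) e i := M%:R * z i - e%:R * \sum_j z j.
have shift0 n (z : 'I_n -> R) e : (n * e = M)%N -> \sum_i shift n z e i = 0.
  move=> E; rewrite sumrB -mulr_sumr sumr_const card_ord -[_ *+ n]mulr_natl mulrA -natrM E.
  by rewrite subrr.
have shiftE n (z : 'I_n -> R) e i0 :
    \sum_i z i * ((if i == i0 then M else 0%N)%:Z - e%:Z)%:~R = shift n z e i0.
  under eq_bigr do rewrite rmorphB /= mulrBr.
  rewrite sumrB /shift -mulr_suml [_%:R * \sum_j _]mulrC; congr (_ - _).
  rewrite (bigD1 i0) //= eqxx big1 ?addr0; first by rewrite mulrC.
  by move=> i /negPf ->; rewrite mulr0.
exists (shift m1 (fun i => y (inl (inl i))) (m2 * m3)%N),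
       (shift m2 (fun i => y (inl (inr i))) (m1 * m3)%N),
       (shift m3 (fun i => y (inr i)) (m1 * m2)%N); split.
- by apply: shift0; rewrite /M mulnA.
- by apply: shift0; rewrite /M mulnCA mulnA.
- by apply: shift0; rewrite /M mulnC.
move=> x xS; have := yP (vec x) (map_f _ xS).
rewrite /pairing !big_sumType /= -!shiftE.
by congr (0 < _ + _ + _); apply: eq_bigr => i _; rewrite ffunE.
Qed.

End DestabilizingWeights.

(* A weak form of the Hilbert-Mumford criterion: t plays the role of the limit
   of h T over the residue field, the weights those of a one-parameter
   subgroup. *)
Lemma destabilizing_weights (R : realFieldType) (L : fieldType) m1 m2 m3
    (T : tensor L m1 m2 m3) :
  zariski_closure (SL_orbit T) 0 -> (0 < m1 * m2 * m3)%N ->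
  exists (F : fieldType) (phi : {rmorphism L -> F}) (O : set F),
  [/\ is_valuation_ring O, forall c, O (phi c) &
  exists (P1 : 'M[F]_m1) (P2 : 'M[F]_m2) (P3 : 'M[F]_m3) (t : tensor F m1 m2 m3)
    (al : 'I_m1 -> R) (be : 'I_m2 -> R) (ga : 'I_m3 -> R),
  [/\ [/\ mx_over O P1, mx_over O P2, mx_over O P3 & forall x, O (t x)],
      [ffun y => phi (T y)] = tensor_act P1 P2 P3 t,
      [/\ \sum_i al i = 0, \sum_i be i = 0 & \sum_i ga i = 0] &
      forall x, maximal_ideal O (t x) \/ 0 < al x.1.1 + be x.1.2 + ga x.2]].
Proof.
move=> T0 M0.
have [F [phi [ O [g1 [g2 [g3 [valO OL [n1 n2 n3] mT]]]]]]] := valuative_criterion T0 M0.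
have ringO := valO.1.
exists F, phi, O; split=> //.
have [k1 [d1 [h1 [[k1' [Ok1 Ok1' _ k1V]] [h1' [Oh1 Oh1' _ h1V]] E1]]]] :=
  cartan_decomposition valO g1.
have [k2 [d2 [h2 [[k2' [Ok2 Ok2' _ k2V]] [h2' [Oh2 Oh2' _ h2V]] E2]]]] :=
  cartan_decomposition valO g2.
have [k3 [d3 [h3 [[k3' [Ok3 Ok3' _ k3V]] [h3' [Oh3 Oh3' _ h3V]] E3]]]] :=
  cartan_decomposition valO g3.
set T' := [ffun y => phi (T y)] in mT *.
pose t := tensor_act h1 h2 h3 T'.
have Ot : forall x, O (t x) by apply: tensor_act_over => // x; rewrite ffunE.
have [d10 O1] := det_cartan valO Ok1 Oh1 (eq_ind _ (fun z => \det z != 0) n1 _ E1).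
have [d20 O2] := det_cartan valO Ok2 Oh2 (eq_ind _ (fun z => \det z != 0) n2 _ E2).
have [d30 O3] := det_cartan valO Ok3 Oh3 (eq_ind _ (fun z => \det z != 0) n3 _ E3).
rewrite -E1 in O1; rewrite -E2 in O2; rewrite -E3 in O3.
have dt x : tensor_act k1' k2' k3' (tensor_act g1 g2 g3 T') x
    = d1 0 x.1.1 * d2 0 x.1.2 * d3 0 x.2 * t x.
  rewrite -tensor_act_diag /t !tensor_act_comp E1 E2 E3.
  by rewrite !mulmxA k1V k2V k3V !mul1mx.
(* Only the coordinates at which [t] is a unit of O impose an inequality. *)
have [||||al [be [ga [al0 be0 ga0 pos]]]] := @torus_weights F O valO R m1 m2 m3
  (d1 0) (d2 0) (d3 0) [seq x <- enum {: 'I_m1 * 'I_m2 * 'I_m3} |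
     `[< ~ maximal_ideal O (t x) >]] => //.
  move=> x; rewrite mem_filter => /andP[/asboolP nm _].
  have [tx0 OtV] := maximal_ideal_unit (Ot x) nm.
  set M := (m1 * m2 * m3)%N in M0 mT *.
  pose e := \det g1 ^+ (m2 * m3) * \det g2 ^+ (m1 * m3) * \det g3 ^+ (m1 * m2).
  have : maximal_ideal O ((d1 0 x.1.1 * d2 0 x.1.2 * d3 0 x.2 * t x) ^+ M / e).
    rewrite -dt tensor_actE; apply: maximal_ideal_power_sum => // p.
    by do !apply: subringM => //.
  set p1 := \prod_i d1 0 i in O1 *; set p2 := \prod_i d2 0 i in O2 *.
  set p3 := \prod_i d3 0 i in O3 *.
  (* Multiplying by this element of O removes [t x] and replaces each determinant by the product of
     the diagonal entries of its Cartan form. *)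
  have OV : O ((t x)^-1 ^+ M * ((\det g1 / p1) ^+ (m2 * m3) *
      (\det g2 / p2) ^+ (m1 * m3) * (\det g3 / p3) ^+ (m1 * m2))).
    by do !apply: subringM => //; exact: subringX.
  move=> /(maximal_idealMl valO OV); congr (maximal_ideal O _).
  rewrite !expr_div_n exprVn !exprMn /e.
  have p0 n (d : 'rV[F]_n) k : (forall i, d 0 i != 0) -> (\prod_i d 0 i) ^+ k != 0.
    by move=> d0; apply/expf_neq0/prodf_neq0.
  have := p0 _ _ (m2 * m3)%N d10; have := p0 _ _ (m1 * m3)%N d20.
  have := p0 _ _ (m1 * m2)%N d30; rewrite -/p1 -/p2 -/p3.
  have := expf_neq0 (m2 * m3) n1; have := expf_neq0 (m1 * m3) n2.
  have := expf_neq0 (m1 * m2) n3; have := expf_neq0 M tx0.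
  move: (t x ^+ M) (\det g1 ^+ _) (\det g2 ^+ _) (\det g3 ^+ _) (p1 ^+ _)
    (p2 ^+ _) (p3 ^+ _) (d1 0 x.1.1 ^+ M) (d2 0 x.1.2 ^+ M) (d3 0 x.2 ^+ M).
  move=> *; field; do !(apply/andP; split => //).
exists h1', h2', h3', t, al, be, ga; split=> //.
  by rewrite /t tensor_act_comp h1V h2V h3V tensor_act1.
move=> x; have [m|nm] := pselect (maximal_ideal O (t x)); [by left|right].
by apply: pos; rewrite mem_filter mem_enum andbT; apply/asboolP.
Qed.

(** * Slices of powers *)

(** Weaker than [has_slice_decomposition]: terms may vanish and the counts are only bounds, so that
    no rank condition has to be carried along; [slice_sum_decomposition] discards the zero terms at
    the end. *)
Definition slice_sum (K : fieldType) (X Y Z : finType) (t : X -> Y -> Z -> K)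
    (r1 r2 r3 : nat) : Prop :=
  exists I1 I2 I3 : finType,
  [/\ (#|I1| <= r1)%N, (#|I2| <= r2)%N, (#|I3| <= r3)%N &
  exists (a : I1 -> X -> K) (a' : I1 -> Y -> Z -> K)
    (b : I2 -> Y -> K) (b' : I2 -> X -> Z -> K)
    (c : I3 -> Z -> K) (c' : I3 -> X -> Y -> K),
  forall x y z, t x y z = \sum_i a i x * a' i y z + \sum_i b i y * b' i x z
    + \sum_i c i z * c' i x y].

(** If A is the matrix of the family and B a pseudo-inverse, P = 1 - B A satisfies A P = 0, and
    every row vector splits as f = f P + (f B) A. *)
Lemma annihilator_projection (K : fieldType) (X I : finType) (a : I -> X -> K) :
  exists (p : X -> X -> K) (b : I -> X -> K),
    (forall i x', \sum_x a i x * p x x' = 0) /\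
    (forall (f : X -> K) x',
       f x' = \sum_x p x x' * f x + \sum_i a i x' * \sum_x b i x * f x).
Proof.
pose A : 'M[K]_(#|I|, #|X|) := \matrix_(i, j) a (enum_val i) (enum_val j).
pose B := pinvmx A; pose P := 1%:M - B *m A.
have AP : A *m P = 0 by rewrite mulmxBr mulmx1 mulmxA mulmxKpV ?subrr.
exists (fun x x' => P (enum_rank x) (enum_rank x')),
       (fun i x => B (enum_rank x) (enum_rank i)); split=> [i x'|f x'].
  have /matrixP/(_ (enum_rank i) (enum_rank x')) := AP; rewrite !mxE => E.
  rewrite -[RHS]E [RHS](reindex enum_rank) /=; last exact/onW_bij/enum_rank_bij.
  by apply: eq_bigr => x _; rewrite !mxE !enum_rankK.
have -> : \sum_i a i x' * (\sum_x B (enum_rank x) (enum_rank i) * f x)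
    = \sum_x (B *m A) (enum_rank x) (enum_rank x') * f x.
  under eq_bigr do rewrite mulr_sumr; rewrite exchange_big /=.
  apply: eq_bigr => x _; rewrite mxE mulr_suml.
  rewrite [RHS](reindex enum_rank) /=; last exact/onW_bij/enum_rank_bij.
  by apply: eq_bigr => i _; rewrite !mxE !enum_rankK; ring.
rewrite -big_split /=; under eq_bigr do rewrite -mulrDl /P mxE [(- (B *m A)) _ _]mxE subrK mxE.
rewrite (bigD1 x') //= eqxx mul1r big1 ?addr0 // => x /negPf xx'.
by rewrite (inj_eq enum_rank_inj) xx' mul0r.
Qed.

(** As a trilinear form, [t] vanishes on the product of the three annihilators. Splitting one
    argument at a time by [annihilator_projection] splits off slices in that direction; what remains
    is [t] evaluated at columns of the three projections, which is 0. *)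
Lemma slice_sum_of_vanishing (K : fieldType) (X Y Z I1 I2 I3 : finType)
    (t : X -> Y -> Z -> K) (a : I1 -> X -> K) (b : I2 -> Y -> K) (c : I3 -> Z -> K) :
  (forall u v w, (forall i, \sum_x a i x * u x = 0) ->
     (forall i, \sum_y b i y * v y = 0) -> (forall i, \sum_z c i z * w z = 0) ->
     \sum_z w z * \sum_y v y * \sum_x u x * t x y z = 0) ->
  slice_sum t #|I1| #|I2| #|I3|.
Proof.
move=> van.
have [p [p' [ap pE]]] := annihilator_projection a.
have [q [q' [bq qE]]] := annihilator_projection b.
have [r [r' [cr rE]]] := annihilator_projection c.
exists I1, I2, I3; split=> //.
exists a, (fun i y z => \sum_x p' i x * t x y z),
  b, (fun i x z => \sum_y q' i y * \sum_x' p x' x * t x' y z),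
  c, (fun i x y => \sum_z r' i z * \sum_y' q y' y * \sum_x' p x' x * t x' y' z).
move=> x y z; rewrite [LHS](pE (fun x => t x y z)) addrC -addrA; congr (_ + _).
rewrite [LHS](qE (fun y => \sum_x' p x' x * t x' y z)) addrC; congr (_ + _).
rewrite [LHS](rE (fun z => \sum_y' q y' y * \sum_x' p x' x * t x' y' z)).
by rewrite van ?add0r.
Qed.

Lemma sum_triple_nested (V : nmodType) (X Y Z : finType) (g : X -> Y -> Z -> V) :
  \sum_z \sum_y \sum_x g x y z = \sum_(p : X * Y * Z) g p.1.1 p.1.2 p.2.
Proof.
rewrite exchange_big /=; under eq_bigr do rewrite exchange_big /=.
rewrite exchange_big /= pair_big pair_big /=.
by apply: eq_bigr => -[[x y] z].
Qed.

Section JointTypes.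
Variables (q m : nat).

(** No count exceeds q, so [inord] loses nothing, and there are only (q+1)^(m^2) possible values,
    polynomially many in q. *)
Definition joint_type (x w : {ffun 'I_q -> 'I_m}) : {ffun 'I_m * 'I_m -> 'I_q.+1} :=
  [ffun p => inord #|[pred s | (x s, w s) == p]|].

Lemma prod_joint_type (F : comNzRingType) (P : 'I_m -> 'I_m -> F)
    (x w : {ffun 'I_q -> 'I_m}) :
  \prod_s P (x s) (w s) = \prod_p P p.1 p.2 ^+ joint_type x w p.
Proof.
rewrite (partition_big (fun s => (x s, w s)) predT) //=.
apply: eq_bigr => p _; rewrite ffunE inordK; last first.
  by rewrite ltnS (leq_trans (max_card _)) // card_ord.
by rewrite -prodr_const; apply: eq_big => [//|s /eqP <-].
Qed.

(* Entries of the q-th power of a matrix only depend on the joint type of the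
   row and column words; hence a small subspace, independent of the matrix and
   defined over the prime field, contains the columns w of all these powers. *)
Lemma joint_type_annihilates (K F : fieldType) (phi : {rmorphism K -> F})
    (P : 'M[F]_m) (w : {ffun 'I_q -> 'I_m}) (u : {ffun 'I_q -> 'I_m} -> K) :
  (forall mu, \sum_x (mu == joint_type x w)%:R * u x = 0) ->
  \sum_x phi (u x) * \prod_s P (x s) (w s) = 0.
Proof.
move=> uw; under eq_bigr do rewrite prod_joint_type.
rewrite (partition_big (fun x => joint_type x w) predT) //= big1 // => mu _.
under eq_bigr => x /eqP E do rewrite E.
rewrite -mulr_suml -rmorph_sum -[X in phi X](_ : \sum_x (mu == joint_type x w)%:R * u x = _).
  by rewrite uw rmorph0 mul0r.
rewrite [RHS]big_mkcond; apply: eq_bigr => x _; rewrite eq_sym.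
by case: eqP => _; rewrite ?mul1r ?mul0r.
Qed.

End JointTypes.

Definition heavy (R : realFieldType) (eps : R) m (h : 'I_m -> R) q :
    {set {ffun 'I_q -> 'I_m}} :=
  [set w : {ffun 'I_q -> 'I_m} | q%:R * eps <= \sum_s h (w s)].

Section PowerBound.
Variables (R : realFieldType) (K F : fieldType) (phi : {rmorphism K -> F}).
Variables (O : set F) (valO : is_valuation_ring O).
Hypothesis OK : forall c, O (phi c).
Variables (m1 m2 m3 : nat) (T : tensor K m1 m2 m3) (t : tensor F m1 m2 m3).
Variables (P1 : 'M[F]_m1) (P2 : 'M[F]_m2) (P3 : 'M[F]_m3).
Variables (al : 'I_m1 -> R) (be : 'I_m2 -> R) (ga : 'I_m3 -> R) (eps : R).
Hypotheses (OP1 : mx_over O P1) (OP2 : mx_over O P2) (OP3 : mx_over O P3).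
Hypothesis Ot : forall x, O (t x).
Hypothesis TE : [ffun y => phi (T y)] = tensor_act P1 P2 P3 t.
Hypothesis pos : forall x,
  maximal_ideal O (t x) \/ 3 * eps < al x.1.1 + be x.1.2 + ga x.2.
Let ringO := valO.1.

Lemma power_expand q (x : {ffun 'I_q -> 'I_m1}) (y : {ffun 'I_q -> 'I_m2})
    (z : {ffun 'I_q -> 'I_m3}) :
  phi (\prod_s T (x s, y s, z s)) =
  \sum_(f : {ffun 'I_q -> 'I_m1 * 'I_m2 * 'I_m3})
    (\prod_s P1 (x s) (f s).1.1) * (\prod_s P2 (y s) (f s).1.2) *
    (\prod_s P3 (z s) (f s).2) * \prod_s t (f s).
Proof.
rewrite rmorph_prod /=.
under eq_bigr => s _.
  rewrite (_ : phi _ = tensor_act P1 P2 P3 t (x s, y s, z s)); last by rewrite -TE ffunE.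
  rewrite tensor_actE; over.
rewrite bigA_distr_bigA /=; apply: eq_bigr => f _.
by rewrite -!big_split.
Qed.

(** The test vectors are orthogonal to the indicators of all joint types with heavy words. After the
    expansion through P1, P2, P3 and [t], a word [f] with a heavy component contributes 0. Otherwise
    the total weight of [f] is below 3 q eps, so at some letter the entry of [t] is in the maximal
    ideal, and with it the whole term. The sum is in the maximal ideal and in the image of K, hence
    0. *)
Lemma power_slice_sum q :
  slice_sum (fun (x : {ffun 'I_q -> 'I_m1}) (y : {ffun 'I_q -> 'I_m2})
      (z : {ffun 'I_q -> 'I_m3}) => \prod_s T (x s, y s, z s))
    (#|heavy eps al q| * q.+1 ^ (m1 * m1)) (#|heavy eps be q| * q.+1 ^ (m2 * m2))
    (#|heavy eps ga q| * q.+1 ^ (m3 * m3)).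
Proof.
pose I m (h : 'I_m -> R) : finType :=
  ({w : {ffun 'I_q -> 'I_m} | w \in heavy eps h q} * {ffun 'I_m * 'I_m -> 'I_q.+1})%type.
have cI m h : #|{: I m h}| = (#|heavy eps h q| * q.+1 ^ (m * m))%N.
  by rewrite card_prod card_sig card_ffun card_ord card_prod !card_ord.
rewrite -!cI.
pose fam m h (i : I m h) x : K := (i.2 == joint_type x (val i.1))%:R.
apply: (@slice_sum_of_vanishing _ _ _ _ _ _ _ _ (@fam m1 al) (@fam m2 be) (@fam m3 ga)).
move=> u v w uP vP wP.
have ann m h P (g : {ffun 'I_q -> 'I_m} -> K) f :
    (forall i, \sum_x @fam m h i x * g x = 0) -> f \in heavy eps h q ->
    \sum_x phi (g x) * \prod_s (P : 'M[F]_m) (x s) (f s) = 0.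
  by move=> gP hf; apply: joint_type_annihilates => mu; apply: (gP (Sub f hf, mu)).
set val := \sum_z _.
have mval : maximal_ideal O (phi val).
  have -> : phi val = \sum_(f : {ffun 'I_q -> 'I_m1 * 'I_m2 * 'I_m3})
      (\sum_x phi (u x) * \prod_s P1 (x s) (f s).1.1) *
      (\sum_y phi (v y) * \prod_s P2 (y s) (f s).1.2) *
      (\sum_z phi (w z) * \prod_s P3 (z s) (f s).2) * \prod_s t (f s).
    under [RHS]eq_bigr do rewrite -sum_triple mulr_suml.
    rewrite [RHS]exchange_big /=.
    transitivity (phi (\sum_z \sum_y \sum_x
        u x * v y * w z * \prod_s T (x s, y s, z s))).
      congr (phi _); apply: eq_bigr => z _; rewrite mulr_sumr.
      apply: eq_bigr => y _; rewrite !mulr_sumr; apply: eq_bigr => x _.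
      by ring.
    rewrite sum_triple_nested rmorph_sum; apply: eq_bigr => -[[x y] z] _ /=.
    rewrite rmorphM /= power_expand mulr_sumr; apply: eq_bigr => f _.
    by rewrite !rmorphM /=; ring.
  apply: maximal_ideal_sum => // f _.
  have Osum m (P : 'M[F]_m) (g : {ffun 'I_q -> 'I_m} -> K) (h : 'I_q -> 'I_m) :
      mx_over O P -> O (\sum_x phi (g x) * \prod_s P (x s) (h s)).
    move=> OP; apply: subring_sum => // x _; apply: subringM => //.
    by apply: subring_prod => // s _.
  pose f1 := [ffun s => (f s).1.1]; pose f2 := [ffun s => (f s).1.2].
  pose f3 := [ffun s => (f s).2].
  have fold m (P : 'M[F]_m) (g : {ffun 'I_q -> 'I_m} -> K) h :
      \sum_x phi (g x) * \prod_s P (x s) (h s)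
      = \sum_x phi (g x) * \prod_s P (x s) ([ffun s => h s] s).
    by apply: eq_bigr => x _; congr (_ * _); apply: eq_bigr => s _; rewrite ffunE.
  have [h1|h1] := boolP (f1 \in heavy eps al q).
    rewrite [X in X * _ * _ * _]fold (ann _ _ _ _ _ uP h1) !mul0r; by left.
  have [h2|h2] := boolP (f2 \in heavy eps be q).
    rewrite [X in _ * X * _ * _]fold (ann _ _ _ _ _ vP h2) mulr0 !mul0r; by left.
  have [h3|h3] := boolP (f3 \in heavy eps ga q).
    rewrite [X in _ * _ * X * _]fold (ann _ _ _ _ _ wP h3) mulr0 !mul0r; by left.
  apply: maximal_idealMl => //.
    by apply: subringM => //; [apply: subringM => //|]; exact: Osum.
  suff [s ms] : exists s, maximal_ideal O (t (f s)).
    rewrite (bigD1 s) //= mulrC; apply: maximal_idealMl => //.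
    by apply: subring_prod => // s' _.
  apply: contrapT => nm.
  have big s : 3 * eps < al (f s).1.1 + be (f s).1.2 + ga (f s).2.
    by have [m|//] := pos (f s); case: nm; exists s.
  have : q%:R * (3 * eps) <= \sum_s (al (f1 s) + be (f2 s) + ga (f3 s)).
    have -> : q%:R * (3 * eps) = \sum_(s < q) 3 * eps :> R.
      by rewrite sumr_const card_ord mulr_natl.
    by apply: ler_sum => s _; rewrite !ffunE ltW.
  move: h1 h2 h3; rewrite !inE -!ltNge !big_split /=; lra.
case: mval => [/eqP|nO]; first by rewrite fmorph_eq0 => /eqP.
by case: nO; rewrite -fmorphV; exact: OK.
Qed.

End PowerBound.

(* Chernoff bound, with exp (l * (h - eps)) as Markov weight for small l. *)
Lemma card_heavy (R : realType) m (h : 'I_m -> R) (eps : R) :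
  \sum_i h i = 0 -> 0 < eps -> (0 < m)%N ->
  exists rho : R, [/\ 0 < rho, rho < 1 &
    forall q, #|heavy eps h q|%:R <= (rho * m%:R) ^+ q].
Proof.
move=> h0 eps0 m0; have m0' : 0 < m%:R :> R by rewrite ltr0n.
pose d i := h i - eps.
pose A := \sum_i `|d i|; pose V := \sum_i d i ^+ 2.
have A0 : 0 <= A by apply: sumr_ge0 => i _.
have V0 : 0 <= V by apply: sumr_ge0 => i _; exact: sqr_ge0.
(* Small enough for l d_i <= 1/2, where exp y <= 1/(1 - y) <= 1 + y + 2 y^2, and for 2 l V <= eps /
   2, so that the quadratic terms stay below the linear gain l m eps. *)
pose l := (2 * A + 4 * V / eps + 1)^-1.
have den : 0 < 2 * A + 4 * V / eps + 1.
  by rewrite ltr_wpDl // addr_ge0 ?mulr_ge0 // invr_ge0 ltW.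
have l0 : 0 < l by rewrite invr_gt0.
have lE : l * (2 * A + 4 * V / eps + 1) = 1 by rewrite mulVf ?gt_eqF.
have Ve : 0 <= V / eps by rewrite divr_ge0 // ltW.
have lA : l * A <= 1 / 2 by nra.
have lV : 2 * l * V <= eps / 2.
  have : l * (V / eps) <= 1 / 4 by nra.
  rewrite mulrA ler_pdivrMr //; lra.
have ld i : l * d i <= 1 / 2.
  apply: le_trans lA; rewrite ler_pM2l // (le_trans (ler_norm _)) //.
  by rewrite /A (bigD1 i) //= lerDl sumr_ge0.
have expB i : expR (l * d i) <= 1 + l * d i + 2 * (l * d i) ^+ 2.
  have := expR_ge1Dx (- (l * d i)); rewrite expRN => e.
  have y1 : 0 < 1 - l * d i by have := ld i; lra.
  have : expR (l * d i) <= (1 - l * d i)^-1.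
    rewrite -[expR _]invrK lef_pV2 // posrE ?invr_gt0 ?expR_gt0 //.
  move=> /le_trans; apply; rewrite -div1r ler_pdivrMr //.
  have := ld i; move: (l * d i) => y yh; have := sqr_ge0 y; nra.
pose S := \sum_i expR (l * d i).
have S0 : 0 < S.
  rewrite /S (bigD1 (Ordinal m0)) //= ltr_pwDl ?expR_gt0 //.
  by apply: sumr_ge0 => i _; exact: expR_ge0.
have Sm : S < m%:R.
  apply: (@le_lt_trans _ _ (\sum_i (1 + l * d i + 2 * (l * d i) ^+ 2))).
    by apply: ler_sum => i _.
  rewrite !big_split /= sumr_const card_ord -!mulr_sumr.
  have -> : \sum_i d i = - (m%:R * eps).
    by rewrite sumrB h0 sumr_const card_ord mulr_natl sub0r.
  under [X in 2 * X]eq_bigr do rewrite exprMn.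
  rewrite -mulr_sumr -/V.
  have m1 : 1 <= m%:R :> R by rewrite ler1n.
  have h1 : l * (2 * l * V) <= l * (eps / 2) by rewrite ler_pM2l.
  have h2 : l * eps <= l * (m%:R * eps) by rewrite ler_pM2l // ler_peMl // ltW.
  have h3 : 0 < l * eps by rewrite mulr_gt0.
  have -> : 2 * (l ^+ 2 * V) = l * (2 * l * V) by ring.
  lra.
exists (S / m%:R); split; first by rewrite divr_gt0.
  by rewrite ltr_pdivrMr // mul1r.
move=> q; rewrite divfK ?gt_eqF //.
have -> : S ^+ q = \sum_(w : {ffun 'I_q -> 'I_m}) \prod_s expR (l * d (w s)).
  by rewrite -(bigA_distr_bigA (fun=> fun i => expR (l * d i))) prodr_const card_ord.
have wpos (w : {ffun 'I_q -> 'I_m}) : 0 <= \prod_s expR (l * d (w s)).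
  by apply: prodr_ge0 => s _; exact: expR_ge0.
rewrite (bigID (mem (heavy eps h q))) /= -[X in X <= _]addr0 lerD ?sumr_ge0 //.
rewrite -sum1_card natr_sum; apply: ler_sum => w; rewrite inE => hw.
rewrite -expR_sum -mulr_sumr -expR0 ler_expR mulr_ge0 ?(ltW l0) //.
by rewrite sumrB sumr_const card_ord subr_ge0 -mulr_natl.
Qed.

(** * One-parameter subgroups from slice decompositions *)

(** For c != 0 the subgroup keeps T in its orbit, and the coordinates of the moved tensor are
    polynomials in c. A polynomial [p] vanishing on the orbit thus yields a polynomial in c that is
    0 at every c != 0, hence identically, as L is infinite; at c = 0 its value is that of [p] at the
    tensor 0. *)
Lemma one_parameter_unstable (L : closedFieldType) m1 m2 m3 (T : tensor L m1 m2 m3)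
    (E1 : 'M[L]_m1) (E2 : 'M[L]_m2) (E3 : 'M[L]_m3)
    (e1 : 'I_m1 -> int) (e2 : 'I_m2 -> int) (e3 : 'I_m3 -> int) :
  E1 \in unitmx -> E2 \in unitmx -> E3 \in unitmx ->
  \sum_i e1 i = 0 -> \sum_i e2 i = 0 -> \sum_i e3 i = 0 ->
  (forall x, tensor_act E1 E2 E3 T x = 0 \/ 0 < e1 x.1.1 + e2 x.1.2 + e3 x.2) ->
  zariski_closure (SL_orbit T) 0.
Proof.
move=> u1 u2 u3 s1 s2 s3 pos p porb.
pose T' := tensor_act E1 E2 E3 T.
pose co (x y : 'I_m1 * 'I_m2 * 'I_m3) : L :=
  invmx E1 x.1.1 y.1.1 * invmx E2 x.1.2 y.1.2 * invmx E3 x.2 y.2.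
pose e (y : 'I_m1 * 'I_m2 * 'I_m3) := e1 y.1.1 + e2 y.1.2 + e3 y.2.
(* [absz] alters no exponent that matters: where [T' y] is nonzero, [e y] is positive. *)
pose f x : {poly L} := \sum_y (co x y * T' y) *: 'X^(absz (e y)).
pose q : {poly L} := \sum_(m <- msupp p) (mcoeff m p)%:P *
  \prod_(i < #|{: 'I_m1 * 'I_m2 * 'I_m3}|) f (enum_val i) ^+ m i.
have qE c : q.[c] = meval (fun i => (f (enum_val i)).[c]) p.
  rewrite mevalE /q horner_sum; apply: eq_bigr => m _.
  rewrite hornerM hornerC; congr (_ * _); rewrite horner_prod.
  by apply: eq_bigr => i _; rewrite horner_exp.
pose g n (E : 'M[L]_n) (k : 'I_n -> int) c : 'M[L]_n :=
  invmx E *m diag_mx (\row_i (c ^ k i)) *m E.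
have detg n (E : 'M[L]_n) k c : c != 0 -> E \in unitmx -> \sum_i k i = 0 ->
    \det (g n E k c) = 1.
  move=> c0 uE sk; rewrite /g !det_mulmx det_diag mulrAC -det_mulmx mulVmx // det1 mul1r.
  under eq_bigr do rewrite mxE.
  suff -> : \prod_i c ^ k i = c ^ (\sum_i k i) by rewrite sk expr0z.
  by elim/big_rec2: _ => [|i x y _ ->]; rewrite ?expr0z // expfzDr.
have q0 c : c != 0 -> q.[c] = 0.
  move=> c0; rewrite qE -[RHS](porb (tensor_act (g _ E1 e1 c) (g _ E2 e2 c) (g _ E3 e3 c) T)).
    apply: meval_eq => i; set x := enum_val i.
    rewrite /g -!tensor_act_comp -/T' tensor_actE /f horner_sum.
    apply: eq_bigr => y _; rewrite hornerZ hornerXn tensor_act_diag !mxE.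
    rewrite -!expfzDr // -/(e y).
    have [y0|ey] := pos y; first by rewrite /T' y0 !mulr0 mul0r.
    rewrite -[in RHS](gtz0_abs (ey : 0 < e y)) -exprnP -/(co x y); ring.
  exists (g _ E1 e1 c), (g _ E2 e2 c), (g _ E3 e3 c); split=> //; exact: detg.
have : q = 0.
  apply/eqP; case: eqVneq => // qn0.
  have /closed_nonrootP[c] : q * 'X != 0 by rewrite mulf_neq0 ?polyX_eq0.
  rewrite rootE hornerM hornerX mulf_eq0 negb_or => /andP[qc c0].
  by rewrite q0 ?eqxx in qc.
move=> /(congr1 (fun r : {poly L} => r.[0])); rewrite qE horner0 => <-.
apply: meval_eq => i; rewrite ffunE /f horner_sum big1 // => y _.
rewrite hornerZ hornerXn; have [y0|ey] := pos y; first by rewrite /T' y0 mulr0 mul0r.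
by rewrite expr0n absz_eq0 (gt_eqF (ey : 0 < e y)) mulr0.
Qed.

Section Slices.
Variables (K : fieldType) (m1 m2 m3 : nat).
Implicit Type S : tensor K m1 m2 m3.

Lemma rank1_factor m n (A : 'M[K]_(m, n)) : \rank A = 1%N ->
  exists (a : 'I_m -> K) (b : 'I_n -> K), forall i j, A i j = a i * b j.
Proof.
move=> r1; have := mulmx_base A; move: (col_base A) (row_base A); rewrite r1.
move=> c r E; exists (fun i => c i 0), (fun j => r 0 j) => i j.
by rewrite -E mxE big_ord1.
Qed.

Lemma rank1_outer m n (a : 'I_m -> K) (b : 'I_n -> K) (A : 'M[K]_(m, n)) :
  (forall i j, A i j = a i * b j) -> A != 0 -> \rank A = 1%N.
Proof.
move=> E; rewrite -mxrank_eq0 -lt0n => A0; apply/eqP; rewrite eqn_leq A0 andbT.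
have -> : A = (\col_i a i) *m (\row_j b j).
  by apply/matrixP => i j; rewrite mxE big_ord1 !mxE E.
by rewrite (leq_trans (mxrankM_maxl _ _)) // rank_leq_col.
Qed.

Lemma slice1P S : slice1 S <-> S != 0 /\ exists (a : 'I_m1 -> K) (b : 'I_m2 -> 'I_m3 -> K),
  forall i j k, S (i, j, k) = a i * b j k.
Proof.
split=> [r1|[S0 [a [b E]]]].
  have [a [b ab]] := rank1_factor r1; split.
    apply/eqP => S0; move: r1; rewrite /slice1 S0 (_ : flattening1 0 = 0) ?mxrank0 //.
    apply/matrixP => i j; rewrite !mxE; case/mxvec_indexP: j => j k.
    by rewrite mxvecE !mxE ffunE.
  exists a, (fun j k => b (mxvec_index j k)) => i j k.
  by rewrite -ab mxE mxvecE mxE.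
apply: (@rank1_outer _ _ a (fun l => mxvec (\matrix_(j, k) b j k) 0 l)).
  by move=> i l; rewrite mxE; case/mxvec_indexP: l => j k; rewrite !mxvecE !mxE.
apply: contraNneq S0 => F0; apply/eqP/ffunP => -[[i j] k]; rewrite ffunE.
by have /matrixP/(_ i (mxvec_index j k)) := F0; rewrite mxE mxvecE !mxE.
Qed.

Lemma slice2P S : slice2 S <-> S != 0 /\ exists (a : 'I_m2 -> K) (b : 'I_m1 -> 'I_m3 -> K),
  forall i j k, S (i, j, k) = a j * b i k.
Proof.
split=> [r1|[S0 [a [b E]]]].
  have [a [b ab]] := rank1_factor r1; split.
    apply/eqP => S0; move: r1; rewrite /slice2 S0 (_ : flattening2 0 = 0) ?mxrank0 //.
    apply/matrixP => i j; rewrite !mxE; case/mxvec_indexP: j => j k.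
    by rewrite mxvecE !mxE ffunE.
  exists a, (fun j k => b (mxvec_index j k)) => i j k.
  by rewrite -ab mxE mxvecE mxE.
apply: (@rank1_outer _ _ a (fun l => mxvec (\matrix_(j, k) b j k) 0 l)).
  by move=> i l; rewrite mxE; case/mxvec_indexP: l => j k; rewrite !mxvecE !mxE.
apply: contraNneq S0 => F0; apply/eqP/ffunP => -[[i j] k]; rewrite ffunE.
by have /matrixP/(_ j (mxvec_index i k)) := F0; rewrite mxE mxvecE !mxE.
Qed.

Lemma slice3P S : slice3 S <-> S != 0 /\ exists (a : 'I_m3 -> K) (b : 'I_m1 -> 'I_m2 -> K),
  forall i j k, S (i, j, k) = a k * b i j.
Proof.
split=> [r1|[S0 [a [b E]]]].
  have [a [b ab]] := rank1_factor r1; split.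
    apply/eqP => S0; move: r1; rewrite /slice3 S0 (_ : flattening3 0 = 0) ?mxrank0 //.
    apply/matrixP => i j; rewrite !mxE; case/mxvec_indexP: j => j k.
    by rewrite mxvecE !mxE ffunE.
  exists a, (fun j k => b (mxvec_index j k)) => i j k.
  by rewrite -ab mxE mxvecE mxE.
apply: (@rank1_outer _ _ a (fun l => mxvec (\matrix_(j, k) b j k) 0 l)).
  by move=> i l; rewrite mxE; case/mxvec_indexP: l => j k; rewrite !mxvecE !mxE.
apply: contraNneq S0 => F0; apply/eqP/ffunP => -[[i j] k]; rewrite ffunE.
by have /matrixP/(_ k (mxvec_index i j)) := F0; rewrite mxE mxvecE !mxE.
Qed.

End Slices.

(** Up to an invertible left factor, the matrix of the family is an r x m [pid_mx] times
    [row_ebase], and the columns of this [pid_mx] from index r on are 0. *)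
Lemma adapted_basis (K : fieldType) (r m : nat) (a : 'I_r -> 'I_m -> K) :
  exists2 E : 'M[K]_m, E \in unitmx &
    forall i (x : 'I_m), (r <= x)%N -> \sum_j E x j * a i j = 0.
Proof.
pose A : 'M[K]_(r, m) := \matrix_(i, j) a i j.
exists (invmx (row_ebase A))^T; first by rewrite unitmx_tr unitmx_inv row_ebase_unit.
move=> i x rx.
have : (A *m invmx (row_ebase A)) i x = 0.
  rewrite -{1}(mulmx_ebase A) mulmxK ?row_ebase_unit // mxE big1 // => j _.
  rewrite mxE [X in X && _](_ : _ = false) ?mulr0 //.
  apply/negbTE/eqP => jx; have := ltn_ord j; rewrite jx.
  by rewrite ltnNge rx.
rewrite mxE => E; rewrite -[RHS]E; apply: eq_bigr => j _.
by rewrite !mxE mulrC.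
Qed.

Lemma sum_step_weights m r M e : (r <= m)%N -> (r * M = m * e)%N ->
  \sum_(x < m) ((if (x < r)%N then M else 0%N)%:Z - e%:Z) = 0.
Proof.
move=> rm E; rewrite sumrB sumr_const card_ord.
have -> : \sum_(x < m) (if (x < r)%N then M else 0%N)%:Z = (r * M)%N%:Z.
  rewrite (eq_bigr (fun x : 'I_m => if (x < r)%N then M%:Z else 0)); last first.
    by move=> x _; case: ifP.
  by rewrite -big_mkcond /= (big_ord_narrow rm) /= sumr_const card_ord -mulr_natl natz.
by rewrite E PoszM -mulr_natl natz subrr.
Qed.

Lemma tensor_act_map (K L : fieldType) (iota : {rmorphism K -> L}) m1 m2 m3
    (E1 : 'M[K]_m1) (E2 : 'M[K]_m2) (E3 : 'M[K]_m3) (T : tensor K m1 m2 m3) x :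
  tensor_act (map_mx iota E1) (map_mx iota E2) (map_mx iota E3)
    [ffun y => iota (T y)] x = iota (tensor_act E1 E2 E3 T x).
Proof.
rewrite !tensor_actE rmorph_sum; apply: eq_bigr => p _.
by rewrite !mxE ffunE !rmorphM.
Qed.

Lemma slices_unstable (K : fieldType) (L : closedFieldType)
    (iota : {rmorphism K -> L}) m1 m2 m3 (T : tensor K m1 m2 m3) r1 r2 r3 :
  (0 < m1 * m2 * m3)%N -> has_slice_decomposition T r1 r2 r3 ->
  (r1 * (m2 * m3) + r2 * (m1 * m3) + r3 * (m1 * m2) < m1 * m2 * m3)%N ->
  ~ semistable iota T.
Proof.
move=> M0 [A [B [C [sA sB sC TE]]]] lt; apply; set M := (m1 * m2 * m3)%N in M0 lt.
have rm1 : (r1 <= m1)%N.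
  have m0 : (0 < m2 * m3)%N by move: M0; rewrite /M -mulnA muln_gt0 => /andP[].
  have E : M = (m1 * (m2 * m3))%N by rewrite mulnA.
  by rewrite -(leq_pmul2r m0) -E (leq_trans _ (ltnW lt)) // -addnA leq_addr.
have rm2 : (r2 <= m2)%N.
  have E : M = (m2 * (m1 * m3))%N by rewrite mulnCA mulnA.
  have m0 : (0 < m1 * m3)%N by move: M0; rewrite E muln_gt0 => /andP[].
  by rewrite -(leq_pmul2r m0) -E (leq_trans _ (ltnW lt)) // addnAC leq_addl.
have rm3 : (r3 <= m3)%N.
  have E : M = (m3 * (m1 * m2))%N by rewrite mulnC.
  have m0 : (0 < m1 * m2)%N by move: M0; rewrite E muln_gt0 => /andP[].
  by rewrite -(leq_pmul2r m0) -E (leq_trans _ (ltnW lt)) // leq_addl.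
have /boolp.choice[a /boolp.choice[a' aE]] : forall s, exists a b,
    forall i j k, A s (i, j, k) = a i * b j k :> K by move=> s; have [] := (slice1P (A s)).1 (sA s).
have /boolp.choice[b /boolp.choice[b' bE]] : forall s, exists a b,
    forall i j k, B s (i, j, k) = a j * b i k :> K by move=> s; have [] := (slice2P (B s)).1 (sB s).
have /boolp.choice[c /boolp.choice[c' cE]] : forall s, exists a b,
    forall i j k, C s (i, j, k) = a k * b i j :> K by move=> s; have [] := (slice3P (C s)).1 (sC s).
have [E1 u1 E1z] := adapted_basis a.
have [E2 u2 E2z] := adapted_basis b.
have [E3 u3 E3z] := adapted_basis c.
(* Weight M on the first r basis vectors, shifted by e = r M / m to have sum 0. A coordinate with at
   least one index below its r_i has weight at least M minus the three shifts, positive by [lt]; at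
   all other coordinates the three kinds of slices vanish. *)
pose w m r e (x : 'I_m) := (if (x < r)%N then M else 0%N)%:Z - e%:Z.
apply: (@one_parameter_unstable _ _ _ _ _ (map_mx iota E1) (map_mx iota E2)
  (map_mx iota E3) (@w m1 r1 (r1 * (m2 * m3))%N) (@w m2 r2 (r2 * (m1 * m3))%N)
  (@w m3 r3 (r3 * (m1 * m2))%N)); rewrite ?map_unitmx //.
- by apply: sum_step_weights => //; rewrite /M; ring.
- by apply: sum_step_weights => //; rewrite /M; ring.
- by apply: sum_step_weights => //; rewrite /M; ring.
move=> [[x y] z] /=; rewrite tensor_act_map /w.
have [xr|xr] := ltnP x r1; first by right; case: ltnP; case: ltnP; lia.
have [yr|yr] := ltnP y r2; first by right; case: ltnP; lia.
have [zr|zr] := ltnP z r3; first by right; lia.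
left; apply/eqP; rewrite fmorph_eq0; apply/eqP.
have actD S S' : tensor_act E1 E2 E3 (S + S') (x, y, z) =
    tensor_act E1 E2 E3 S (x, y, z) + tensor_act E1 E2 E3 S' (x, y, z).
  rewrite !tensor_actE -big_split; apply: eq_bigr => p _.
  by rewrite ffunE mulrDr.
have act0 r (S : 'I_r -> tensor K m1 m2 m3) :
    (forall s, tensor_act E1 E2 E3 (S s) (x, y, z) = 0) ->
    tensor_act E1 E2 E3 (\sum_s S s) (x, y, z) = 0.
  move=> S0; apply: (big_ind (fun S => tensor_act E1 E2 E3 S (x, y, z) = 0)) => //.
    by rewrite tensor_actE big1 // => p _; rewrite ffunE mulr0.
  by move=> S1 S2 h1 h2; rewrite actD h1 h2 addr0.
have hA s : tensor_act E1 E2 E3 (A s) (x, y, z) = 0.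
  rewrite ffunE /= exchange_big big1 // => j _; rewrite exchange_big big1 // => k _ /=.
  rewrite (eq_bigr (fun i => E2 y j * E3 z k * a' s j k * (E1 x i * a s i))).
    by rewrite -mulr_sumr E1z // mulr0.
  by move=> i _; rewrite aE; ring.
have hB s : tensor_act E1 E2 E3 (B s) (x, y, z) = 0.
  rewrite ffunE /= big1 // => i _; rewrite exchange_big big1 // => k _ /=.
  rewrite (eq_bigr (fun j => E1 x i * E3 z k * b' s i k * (E2 y j * b s j))).
    by rewrite -mulr_sumr E2z // mulr0.
  by move=> j _; rewrite bE; ring.
have hC s : tensor_act E1 E2 E3 (C s) (x, y, z) = 0.
  rewrite ffunE /= big1 // => i _; rewrite big1 // => j _ /=.
  rewrite (eq_bigr (fun k => E1 x i * E2 y j * c' s i j * (E3 z k * c s k))).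
    by rewrite -mulr_sumr E3z // mulr0.
  by move=> k _; rewrite cE; ring.
by rewrite TE !actD !act0 // !addr0.
Qed.

(** * Slice decompositions of Kronecker products *)

Lemma slice_sum_decomposition (K : fieldType) m1 m2 m3 (T : tensor K m1 m2 m3)
    r1 r2 r3 : slice_sum (fun i j k => T (i, j, k)) r1 r2 r3 ->
  exists s1 s2 s3, [/\ (s1 <= r1)%N, (s2 <= r2)%N, (s3 <= r3)%N &
    has_slice_decomposition T s1 s2 s3].
Proof.
move=> [I1 [I2 [I3 [l1 l2 l3 [a [a' [b [b' [c [c' E]]]]]]]]]].
pose A i : tensor K m1 m2 m3 := [ffun x => a i x.1.1 * a' i x.1.2 x.2].
pose B i : tensor K m1 m2 m3 := [ffun x => b i x.1.2 * b' i x.1.1 x.2].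
pose C i : tensor K m1 m2 m3 := [ffun x => c i x.2 * c' i x.1.1 x.1.2].
have nz (I : finType) (S : I -> tensor K m1 m2 m3) :
    \sum_i S i = \sum_(s < #|[pred i | S i != 0]|) S (enum_val s).
  rewrite -(big_enum_val S) /= [RHS]big_mkcond; apply: eq_bigr => i _.
  by rewrite inE; case: eqP.
exists #|[pred i | A i != 0]|, #|[pred i | B i != 0]|, #|[pred i | C i != 0]|.
split; try by apply: leq_trans (max_card _) _.
exists (fun s => A (enum_val s)), (fun s => B (enum_val s)), (fun s => C (enum_val s)).
split.
- move=> s; apply/slice1P; split; first by have := enum_valP s; rewrite inE.
  by exists (a (enum_val s)), (a' (enum_val s)) => i j k; rewrite ffunE.
- move=> s; apply/slice2P; split; first by have := enum_valP s; rewrite inE.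
  by exists (b (enum_val s)), (b' (enum_val s)) => i j k; rewrite ffunE.
- move=> s; apply/slice3P; split; first by have := enum_valP s; rewrite inE.
  by exists (c (enum_val s)), (c' (enum_val s)) => i j k; rewrite ffunE.
rewrite -!nz; apply/ffunP => -[[i j] k]; rewrite E !ffunE !sum_ffunE.
by congr (_ + _ + _); apply: eq_bigr => s _; rewrite ffunE.
Qed.

Lemma slice_sum_reindex (K : fieldType) (X Y Z X' Y' Z' : finType)
    (t : X -> Y -> Z -> K) (t' : X' -> Y' -> Z' -> K) (f : X' -> X) (g : Y' -> Y)
    (h : Z' -> Z) r1 r2 r3 :
  (forall x y z, t' x y z = t (f x) (g y) (h z)) ->
  slice_sum t r1 r2 r3 -> slice_sum t' r1 r2 r3.
Proof.
move=> tE [I1 [I2 [I3 [l1 l2 l3 [a [a' [b [b' [c [c' E]]]]]]]]]].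
exists I1, I2, I3; split=> //.
exists (fun i x => a i (f x)), (fun i y z => a' i (g y) (h z)),
  (fun i y => b i (g y)), (fun i x z => b' i (f x) (h z)),
  (fun i z => c i (h z)), (fun i x y => c' i (f x) (g y)) => x y z.
by rewrite tE E.
Qed.

(** A slice in the first direction times any [t'] splits into one slice for each element of X', by
    inserting the indicator of that element; likewise in the other directions. *)
Lemma slice_sum_product (K : fieldType) (X Y Z X' Y' Z' : finType)
    (t : X -> Y -> Z -> K) (t' : X' -> Y' -> Z' -> K) r1 r2 r3 :
  slice_sum t r1 r2 r3 ->
  slice_sum (fun (x : X * X') (y : Y * Y') (z : Z * Z') =>
      t x.1 y.1 z.1 * t' x.2 y.2 z.2)
    (r1 * #|X'|) (r2 * #|Y'|) (r3 * #|Z'|).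
Proof.
move=> [I1 [I2 [I3 [l1 l2 l3 [a [a' [b [b' [c [c' E]]]]]]]]]].
exists (I1 * X')%type, (I2 * Y')%type, (I3 * Z')%type.
split; rewrite ?card_prod ?leq_mul //.
exists (fun i x => a i.1 x.1 * (i.2 == x.2)%:R),
  (fun i y z => a' i.1 y.1 z.1 * t' i.2 y.2 z.2),
  (fun i y => b i.1 y.1 * (i.2 == y.2)%:R),
  (fun i x z => b' i.1 x.1 z.1 * t' x.2 i.2 z.2),
  (fun i z => c i.1 z.1 * (i.2 == z.2)%:R),
  (fun i x y => c' i.1 x.1 y.1 * t' x.2 y.2 i.2) => x y z.
have split2 (I W : finType) (w : W) (f g : I -> K) (h : W -> K) :
    \sum_(i : I * W) (f i.1 * (i.2 == w)%:R) * (g i.1 * h i.2)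
    = (\sum_i f i * g i) * h w.
  rewrite -(pair_big predT predT (fun i v => f i * (v == w)%:R * (g i * h v))) /=.
  rewrite mulr_suml; apply: eq_bigr => i _.
  rewrite (bigD1 w) //= eqxx mulr1 big1 ?addr0; first by rewrite mulrA.
  by move=> v /negPf ->; rewrite mulr0 mul0r.
rewrite E !mulrDl.
rewrite (split2 _ _ x.2 (a^~ x.1) (fun i => a' i y.1 z.1) (fun v => t' v y.2 z.2)).
rewrite (split2 _ _ y.2 (b^~ y.1) (fun i => b' i x.1 z.1) (fun v => t' x.2 v z.2)).
by rewrite (split2 _ _ z.2 (c^~ z.1) (fun i => c' i x.1 y.1) (fun v => t' x.2 y.2 v)).
Qed.

(** The power is regrouped as q blocks of length k followed by e single letters, [mxvec_index s j]
    being position j of block s. This extends bounds from multiples of k to all exponents. *)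
Lemma kronecker_power_blocks (K : fieldType) m1 m2 m3 (T : tensor K m1 m2 m3)
    k q e r1 r2 r3 :
  slice_sum (fun (x : {ffun 'I_q -> 'I_#|{ffun 'I_k -> 'I_m1}|})
      (y : {ffun 'I_q -> 'I_#|{ffun 'I_k -> 'I_m2}|})
      (z : {ffun 'I_q -> 'I_#|{ffun 'I_k -> 'I_m3}|}) =>
      \prod_s kronecker_power T k (x s, y s, z s)) r1 r2 r3 ->
  slice_sum (fun x y z => kronecker_power T (q * k + e) (x, y, z))
    (r1 * m1 ^ e) (r2 * m2 ^ e) (r3 * m3 ^ e).
Proof.
pose t' (x : {ffun 'I_e -> 'I_m1}) (y : {ffun 'I_e -> 'I_m2})
  (z : {ffun 'I_e -> 'I_m3}) := \prod_s T (x s, y s, z s).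
have cE m : #|{ffun 'I_e -> 'I_m}| = (m ^ e)%N by rewrite card_ffun !card_ord.
move=> /(@slice_sum_product _ _ _ _ _ _ _ _ t'); rewrite !cE.
pose blocks m (x : 'I_#|{ffun 'I_(q * k + e) -> 'I_m}|) :=
  ([ffun s : 'I_q => enum_rank [ffun j : 'I_k => word x (lshift e (mxvec_index s j))]],
   [ffun j : 'I_e => word x (rshift (q * k) j)]).
apply: (slice_sum_reindex (f := @blocks m1) (g := @blocks m2) (h := @blocks m3)).
move=> x y z; rewrite ffunE /= big_split_ord /t' /=; congr (_ * _); last first.
  by apply: eq_bigr => s _; rewrite !ffunE.
transitivity (\prod_(s < q) \prod_(j < k)
    T (word x (lshift e (mxvec_index s j)), word y (lshift e (mxvec_index s j)),
       word z (lshift e (mxvec_index s j)))).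
  rewrite (reindex _ (curry_mxvec_bij _ _)) pair_bigA /=.
  by apply: eq_bigr => -[s j].
apply: eq_bigr => s _; rewrite !ffunE /=; apply: eq_bigr => j _.
by rewrite /word !enum_rankK !ffunE.
Qed.

(** * Asymptotics *)

Lemma limn_esup_le (R : realType) (u : nat -> \bar R) c N :
  (forall n, (N <= n)%N -> (u n <= c)%E) -> (limn_esup u <= c)%E.
Proof.
move=> uc; apply: (@le_trans _ _ (ereal_sup (u @` [set n | (N <= n)%N]))).
  by apply: ereal_inf_lbound; exists [set n | (N <= n)%N] => //; exists N.
by apply: ge_ereal_sup => _ [n /= Nn <-]; exact: uc.
Qed.

Lemma limn_esup_lt (R : realType) (u : nat -> \bar R) c :
  (limn_esup u < c)%E -> exists N, forall n, (N <= n)%N -> (u n < c)%E.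
Proof.
move=> /ereal_inf_lt[_ [V [N _ NV] <-] sc]; exists N => n Nn.
apply: le_lt_trans sc; apply: ereal_sup_ubound; exists n => //; exact: NV.
Qed.

Lemma expr_eventually_le (R : realType) (s c : R) : 0 <= s -> s < 1 -> 0 < c ->
  exists N, forall q, (N <= q)%N -> s ^+ q <= c.
Proof.
move=> s0 s1 c0.
have s1' : `|s| < 1 by rewrite ger0_norm.
have /cvgrPdist_le/(_ _ c0)[N _ NP] := cvg_expr s1'.
exists N => q Nq; have := NP q Nq.
by rewrite /= sub0r normrN ger0_norm // exprn_ge0.
Qed.

Lemma poly_expr_eventually_le (R : realType) (s c : R) D : 0 < s -> s < 1 -> 0 < c ->
  exists N, forall q, (N <= q)%N -> q.+1%:R ^+ D * s ^+ q <= c.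
Proof.
(* Of the D + 1 factors u^q of s^q, each of D absorbs one factor q + 1, because (q + 1) u^q is at
   most the geometric series 1/(1 - u); the last one tends to 0. *)
move=> s0 s1 c0; pose u := s `^ D.+1%:R^-1.
have u0 : 0 < u by rewrite powR_gt0.
have uD : u ^+ D.+1 = s.
  by rewrite -powR_mulrn ?powR_ge0 // -powRrM mulVf ?pnatr_eq0 // powRr1 // ltW.
have u1 : u < 1.
  rewrite ltNge; apply/negP => u1; have := exprn_ege1 D.+1 u1.
  by rewrite uD leNgt s1.
pose B := (1 - u)^-1.
have B0 : 0 < B by rewrite invr_gt0 subr_gt0.
have qu q : q.+1%:R * u ^+ q <= B.
  rewrite /B -[X in _ <= X]mul1r ler_pdivlMr ?subr_gt0 //.
  have -> : q.+1%:R * u ^+ q = \sum_(i < q.+1) u ^+ q by rewrite sumr_const card_ord mulr_natl.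
  apply: (@le_trans _ _ ((\sum_(i < q.+1) u ^+ i) * (1 - u))).
    rewrite ler_wpM2r ?subr_ge0 ?(ltW u1) //; apply: ler_sum => i _.
    by rewrite ler_wiXn2l ?(ltW u0) ?(ltW u1) // -ltnS.
  have -> : (\sum_(i < q.+1) u ^+ i) * (1 - u) = 1 - u ^+ q.+1.
    by rewrite -[RHS]opprB subrX1 -mulNr opprB mulrC.
  by rewrite gerBl exprn_ge0 // ltW.
have [N NP] := expr_eventually_le (ltW u0) u1 (divr_gt0 c0 (exprn_gt0 D B0)).
exists N => q /NP; rewrite ler_pdivlMr ?exprn_gt0 // => le.
apply: le_trans le.
have -> : s ^+ q = u ^+ q * (u ^+ q) ^+ D.
  by rewrite -uD -!exprM -exprD mulSn [(D * q)%N]mulnC.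
rewrite mulrCA ler_pM2l ?exprn_gt0 // -exprMn.
rewrite lerXn2r ?nnegrE ?qu ?(ltW B0) // mulr_ge0 // exprn_ge0 // ltW //.
Qed.

(** A rate t between s and 1 leaves room: powers of s/t absorb the polynomial and C, and with rho^k
    = t one spare factor t pays for the remainder rho^e, as e < k. *)
Lemma block_growth (R : realType) (s : R) (k D C : nat) : 0 < s -> s < 1 -> (0 < k)%N ->
  exists rho : R, [/\ 0 < rho, rho < 1 & exists N, forall q e, (N <= q)%N -> (e < k)%N ->
    C%:R * (q.+1%:R ^+ D * s ^+ q) <= rho ^+ (q * k + e)].
Proof.
move=> s0 s1 k0; pose t := (1 + s) / 2; have t0 : 0 < t by rewrite /t; lra.
have st : s < t by rewrite /t; lra.
have t1 : t < 1 by rewrite /t; lra.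
pose rho := t `^ k%:R^-1; have rho0 : 0 < rho by rewrite powR_gt0.
have rhok : rho ^+ k = t.
  rewrite -powR_mulrn ?powR_ge0 // -powRrM mulVf ?powRr1 ?ltW //.
  by rewrite pnatr_eq0 -lt0n.
have rho1 : rho < 1.
  rewrite ltNge; apply/negP => r1; have := exprn_ege1 k r1.
  by rewrite rhok leNgt t1.
have [|||N NP] := @poly_expr_eventually_le R (s / t) (t / C.+1%:R) D.
- exact: divr_gt0.
- by rewrite ltr_pdivrMr // mul1r.
- by rewrite divr_gt0.
exists rho; split=> //; exists N => q e Nq ek.
apply: (@le_trans _ _ (t ^+ q.+1)).
  have := NP q Nq; rewrite expr_div_n [_ * (_ / _)]mulrA ler_pdivrMr ?exprn_gt0 //.
  rewrite [_ / _ * _]mulrAC -exprS ler_pdivlMr ?ltr0n // => h.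
  apply: le_trans h; rewrite mulrC ler_wpM2l ?ler_nat //.
  by rewrite mulr_ge0 ?exprn_ge0 // ltW.
rewrite -rhok -exprM mulnS addnC mulnC exprD [X in _ <= X]exprD.
rewrite ler_pM2l ?exprn_gt0 //.
by rewrite ler_wiXn2l ?(ltW rho0) ?(ltW rho1) ?(ltnW ek).
Qed.

Section UnstableBound.
Variables (R : realType) (K : fieldType) (L : closedFieldType).
Variables (iota : {rmorphism K -> L}) (m1 m2 m3 : nat) (T : tensor K m1 m2 m3).

(** The factor 3 makes room for the three terms of the weighted slice rank. *)
Definition small_slices (rho : R) n : Prop :=
  exists r1 r2 r3, [/\ slice_sum (fun x y z => kronecker_power T n (x, y, z)) r1 r2 r3,
    3 * r1%:R <= (rho * m1%:R) ^+ n, 3 * r2%:R <= (rho * m2%:R) ^+ n &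
    3 * r3%:R <= (rho * m3%:R) ^+ n].

Lemma unstable_small_slices k : (0 < k)%N -> (0 < m1 * m2 * m3)%N ->
  ~ semistable iota (kronecker_power T k) ->
  exists rho : R, [/\ 0 < rho, rho < 1 &
    exists N, forall n, (N <= n)%N -> small_slices rho n].
Proof.
move=> k0 M0 /boolp.contrapT T0.
have [m10 m20 m30] : [/\ (0 < m1)%N, (0 < m2)%N & (0 < m3)%N].
  by move: M0; rewrite !muln_gt0 => /andP[/andP[]].
have cE m : #|{ffun 'I_k -> 'I_m}| = (m ^ k)%N by rewrite card_ffun !card_ord.
have c0 m : (0 < m)%N -> (0 < #|{ffun 'I_k -> 'I_m}|)%N by rewrite cE expn_gt0 => ->.
have [|F [phi [ O [valO OL
  [P1 [P2 [P3 [t [al [be [ga [[OP1 OP2 OP3 Ot] TE [al0 be0 ga0] pos]]]]]]]]]]]] :=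
  destabilizing_weights R T0.
  by rewrite !muln_gt0 !c0.
pose wt (x : 'I_#|{ffun 'I_k -> 'I_m1}| * 'I_#|{ffun 'I_k -> 'I_m2}| *
  'I_#|{ffun 'I_k -> 'I_m3}|) := al x.1.1 + be x.1.2 + ga x.2.
(* Finitely many strict inequalities have a common margin, of which each direction gets a third. *)
have [eps eps0 epsP] : exists2 eps : R, 0 < eps &
    forall x, maximal_ideal O (t x) \/ 3 * eps < wt x.
  suff [d d0 dP] : exists2 d : R, 0 < d &
      forall x, x \in enum {: 'I_#|{ffun 'I_k -> 'I_m1}| * 'I_#|{ffun 'I_k -> 'I_m2}| *
        'I_#|{ffun 'I_k -> 'I_m3}|} -> maximal_ideal O (t x) \/ d < wt x.
    exists (d / 3); first by rewrite divr_gt0.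
    move=> x; have [|h|h] := dP x; [by rewrite mem_enum|by left|right].
    by rewrite mulrC divfK.
  elim: (enum _) => [|x s [d d0 dP]]; first by exists 1.
  have [mx|wx] := pos x.
    by exists d => // y; rewrite inE => /orP[/eqP ->|/dP]; [left|].
  exists (Num.min d (wt x / 2)).
    by rewrite lt_min d0 /= divr_gt0.
  move=> y; rewrite inE => /orP[/eqP ->|/dP[|dy]]; [right|by left|right].
    by rewrite gt_min; apply/orP; right; rewrite ltr_pdivrMr // mulr_natr mulr2n ltrDl.
  by rewrite gt_min dy.
have [s1 [s10 s11 s1P]] := card_heavy al0 eps0 (c0 _ m10).
have [s2 [s20 s21 s2P]] := card_heavy be0 eps0 (c0 _ m20).
have [s3 [s30 s31 s3P]] := card_heavy ga0 eps0 (c0 _ m30).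
pose s := Num.max (Num.max s1 s2) s3.
have s0 : 0 < s by rewrite !lt_max s10.
have s_lt1 : s < 1 by rewrite !gt_max s11 s21 s31.
pose D := maxn (maxn (#|{ffun 'I_k -> 'I_m1}| * #|{ffun 'I_k -> 'I_m1}|)
  (#|{ffun 'I_k -> 'I_m2}| * #|{ffun 'I_k -> 'I_m2}|))
  (#|{ffun 'I_k -> 'I_m3}| * #|{ffun 'I_k -> 'I_m3}|).
(* The constant 3 is the factor in [small_slices]; D bounds the degree in q of the number of joint
   types in every direction. *)
have [rho [rho0 rho1 [N NP]]] := block_growth D 3 s0 s_lt1 k0.
exists rho; split=> //; exists (N.+1 * k)%N => n Nn.
have TE' : [ffun y => (phi \o iota) (kronecker_power T k y)] = tensor_act P1 P2 P3 t.
  by rewrite -TE; apply/ffunP => y; rewrite !ffunE.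
have OK c : O ((phi \o iota) c) by exact: OL.
have := power_slice_sum valO OK OP1 OP2 OP3 Ot TE' epsP (n %/ k).
move=> /(@kronecker_power_blocks _ _ _ _ _ _ _ (n %% k)); rewrite -divn_eq => sl.
have qN : (N <= n %/ k)%N by rewrite ltnW // leq_divRL.
have main m h sm : (0 < m)%N -> 0 < sm -> sm <= s ->
    (#|{ffun 'I_k -> 'I_m}| * #|{ffun 'I_k -> 'I_m}| <= D)%N ->
    #|@heavy R eps #|{ffun 'I_k -> 'I_m}| h (n %/ k)|%:R
      <= (sm * #|{ffun 'I_k -> 'I_m}|%:R) ^+ (n %/ k) ->
    3 * (#|@heavy R eps #|{ffun 'I_k -> 'I_m}| h (n %/ k)| *
      (n %/ k).+1 ^ (#|{ffun 'I_k -> 'I_m}| * #|{ffun 'I_k -> 'I_m}|) * m ^ (n %% k))%N%:R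
    <= (rho * m%:R) ^+ n.
  move=> m0 sm0 sms mD hP; set q := (n %/ k)%N in hP *; set e := (n %% k)%N.
  have nE : n = (q * k + e)%N by exact: divn_eq.
  have le := NP q e qN (ltn_pmod n k0).
  rewrite !natrM !natrX exprMn [in X in _ <= X]nE.
  apply: (@le_trans _ _ (3%:R * (q.+1%:R ^+ D * s ^+ q) * m%:R ^+ n)); last first.
    by rewrite {1}nE ler_pM2r ?exprn_gt0 ?ltr0n.
  rewrite -[X in _ <= X]mulrA ler_pM2l // [in X in _ <= X]nE exprD.
  rewrite [X in _ <= X]mulrA ler_pM2r ?exprn_gt0 ?ltr0n //.
  have mq : #|{ffun 'I_k -> 'I_m}|%:R ^+ q = m%:R ^+ (q * k) :> R.
    by rewrite cE natrX -exprM mulnC.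
  move: hP; rewrite exprMn mq => hP.
  apply: (@le_trans _ _ (sm ^+ q * m%:R ^+ (q * k) * q.+1%:R ^+ D)).
    apply: ler_pM; [exact: ler0n|by rewrite exprn_ge0|exact: hP|].
    by apply: ler_weXn2l mD; rewrite ler1n.
  apply: (@le_trans _ _ (s ^+ q * m%:R ^+ (q * k) * q.+1%:R ^+ D)); last first.
    by rewrite mulrC mulrA lexx.
  rewrite -!mulrA ler_wpM2r ?mulr_ge0 ?exprn_ge0 //.
  by rewrite lerXn2r ?nnegrE ?(ltW sm0) ?(ltW s0).
eexists _, _, _; split; first exact: sl.

- apply: main (s1P _) => //; first by rewrite !le_max lexx.
  by rewrite /D !leq_max leqnn.

- apply: main (s2P _) => //; first by rewrite !le_max lexx !orbT.
  by rewrite /D !leq_max leqnn !orbT.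
- apply: main (s3P _) => //; first by rewrite !le_max lexx !orbT.
  by rewrite /D !leq_max leqnn !orbT.
Qed.

End UnstableBound.

(** * Elementary bounds for the weighted slice rank *)

Section WeightedSliceRank.
Variables (R : realType) (K : fieldType).

Lemma slice_term_ge0 (x : R) r : 0 <= slice_term x r.
Proof. by rewrite /slice_term; case: eqP => // _; exact: powR_ge0. Qed.

Lemma slice_term_le (x : R) r s : 0 <= x -> (r <= s)%N ->
  slice_term x r <= slice_term x s.
Proof.
move=> x0 rs; rewrite /slice_term; case: eqP => // _.
by apply: ge0_ler_powR; rewrite ?nnegrE ?invr_ge0 ?ler_nat.
Qed.

Variables (xi : R * R * R) (m1 m2 m3 : nat) (T : tensor K m1 m2 m3).
Hypotheses (x1 : 0 <= xi.1.1) (x2 : 0 <= xi.1.2) (x3 : 0 <= xi.2).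

Lemma weighted_slice_rank_le r1 r2 r3 :
  slice_sum (fun x y z => T (x, y, z)) r1 r2 r3 ->
  (xi.1.1 = 0 -> r1 = 0%N) -> (xi.1.2 = 0 -> r2 = 0%N) -> (xi.2 = 0 -> r3 = 0%N) ->
  weighted_slice_rank xi T <=
    slice_term xi.1.1 r1 + slice_term xi.1.2 r2 + slice_term xi.2 r3.
Proof.
move=> /slice_sum_decomposition[s1 [s2 [s3 [l1 l2 l3 dec]]]] z1 z2 z3.
apply: (@le_trans _ _ (slice_term xi.1.1 s1 + slice_term xi.1.2 s2 + slice_term xi.2 s3)).
  apply: ge_inf.
    exists 0 => _ [t1 [t2 [t3 [_ _ ->]]]].
    by rewrite !addr_ge0 // slice_term_ge0.
  exists s1, s2, s3; split=> //; split.
  - by move=> /z1 E; apply/eqP; rewrite -leqn0 -E.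
  - by move=> /z2 E; apply/eqP; rewrite -leqn0 -E.
  - by move=> /z3 E; apply/eqP; rewrite -leqn0 -E.
by rewrite !lerD // slice_term_le.
Qed.

Lemma slice_sum_full :
  [/\ slice_sum (fun x y z => T (x, y, z)) m1 0 0,
      slice_sum (fun x y z => T (x, y, z)) 0 m2 0 &
      slice_sum (fun x y z => T (x, y, z)) 0 0 m3].
Proof.
have void0 : (#|{: void}| <= 0)%N by rewrite card_void.
have pick n (f : 'I_n -> K) i : f i = \sum_j (j == i)%:R * f j.
  rewrite (bigD1 i) //= eqxx mul1r big1 ?addr0 // => j /negPf ->.
  by rewrite mul0r.
have sum_void (f : void -> K) : \sum_i f i = 0 by rewrite big1 // => -[].
split.
- exists 'I_m1, void, void; split; rewrite ?card_ord //.
  exists (fun i x => (i == x)%:R), (fun i y z => T (i, y, z)).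
  do 4!exists (of_void _); move=> x y z.
  by rewrite !sum_void !addr0 -(pick _ (fun i => T (i, y, z))).
- exists void, 'I_m2, void; split; rewrite ?card_ord //.
  do 2!exists (of_void _).
  exists (fun i y => (i == y)%:R), (fun i x z => T (x, i, z)).
  do 2!exists (of_void _); move=> x y z.
  by rewrite !sum_void addr0 add0r -(pick _ (fun i => T (x, i, z))).
- exists void, void, 'I_m3; split; rewrite ?card_ord //.
  do 4!exists (of_void _).
  exists (fun i z => (i == z)%:R), (fun i x y => T (x, y, i)) => x y z.
  by rewrite !sum_void !add0r -(pick _ (fun i => T (x, y, i))).
Qed.

Lemma slice_term0 (x : R) : slice_term x 0 = 0.
Proof.
rewrite /slice_term; case: eqP => // /eqP x0.
by rewrite powR0 // invr_eq0.
Qed.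

Lemma weighted_slice_rank_dim :
  [/\ xi.1.1 != 0 -> weighted_slice_rank xi T <= m1%:R `^ xi.1.1^-1,
      xi.1.2 != 0 -> weighted_slice_rank xi T <= m2%:R `^ xi.1.2^-1 &
      xi.2 != 0 -> weighted_slice_rank xi T <= m3%:R `^ xi.2^-1].
Proof.
have [f1 f2 f3] := slice_sum_full.
have tE x m : x != 0 -> slice_term x m = (m%:R : R) `^ x^-1.
  by rewrite /slice_term => /negPf ->.
split=> /[dup] nz /eqP nz'.
- by have := weighted_slice_rank_le f1; rewrite !slice_term0 !addr0 tE //; apply.
- by have := weighted_slice_rank_le f2; rewrite !slice_term0 addr0 add0r tE //; apply.
- by have := weighted_slice_rank_le f3; rewrite !slice_term0 !add0r tE //; apply.
Qed.

Lemma weighted_slice_rank_ge0 : 0 <= weighted_slice_rank xi T.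
Proof.
rewrite /weighted_slice_rank; set S := mkset _.
have [->|/set0P S0] := eqVneq S set0; first by rewrite inf0.
apply: lb_le_inf => // _ [t1 [t2 [t3 [_ _ ->]]]].
by rewrite !addr_ge0 // slice_term_ge0.
Qed.

Lemma weighted_slice_rank_lt c : Xi xi -> weighted_slice_rank xi T < c ->
  exists r1 r2 r3, [/\ has_slice_decomposition T r1 r2 r3,
    [/\ xi.1.1 = 0 -> r1 = 0%N, xi.1.2 = 0 -> r2 = 0%N & xi.2 = 0 -> r3 = 0%N],
    slice_term xi.1.1 r1 < c, slice_term xi.1.2 r2 < c & slice_term xi.2 r3 < c].
Proof.
move=> [_ _ _ xi1]; rewrite /weighted_slice_rank; set S := mkset _ => Sc.
(* Some entry of xi is 1, and slicing completely in that direction respects the constraints. On an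
   empty set [inf] would be the default value 0. *)
have S0 : nonempty S.
  have [f1 f2 f3] := slice_sum_full.
  have one0 : 1 <> 0 :> R by apply/eqP; exact: oner_neq0.
  have : [\/ xi.1.1 = 1, xi.1.2 = 1 | xi.2 = 1].
    move: xi1; case: (leP (Num.max xi.1.1 xi.1.2) xi.2) => _; first by constructor 3.
    by case: (leP xi.1.1 xi.1.2) => _; [constructor 2|constructor 1].
  case=> E.
  - have [s1 [s2 [s3 [_ l2 l3 dec]]]] := slice_sum_decomposition f1.
    eexists; exists s1, s2, s3; split; [exact: dec| |reflexivity].
    by rewrite E; split=> // _; apply/eqP; rewrite -leqn0.
  - have [s1 [s2 [s3 [l1 _ l3 dec]]]] := slice_sum_decomposition f2.
    eexists; exists s1, s2, s3; split; [exact: dec| |reflexivity].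
    by rewrite E; split=> // _; apply/eqP; rewrite -leqn0.
  - have [s1 [s2 [s3 [l1 l2 _ dec]]]] := slice_sum_decomposition f3.
    eexists; exists s1, s2, s3; split; [exact: dec| |reflexivity].
    by rewrite E; split=> // _; apply/eqP; rewrite -leqn0.
have [_ [r1 [r2 [r3 [dec z ->]]]] lt] : exists2 s, S s & s < c.
  apply: contrapT => h; move: Sc; rewrite ltNge; apply/negP/negPn.
  apply: lb_le_inf => // s Ss; rewrite leNgt; apply/negP => sc; apply: h.
  by exists s.
have t1 := slice_term_ge0 xi.1.1 r1; have t2 := slice_term_ge0 xi.1.2 r2.
have t3 := slice_term_ge0 xi.2 r3.
by exists r1, r2, r3; split=> //; apply: le_lt_trans lt; lra.
Qed.

End WeightedSliceRank.

(** * Comparison of the asymptotic slice rank with the dimensions *)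

Lemma powR_root (R : realType) (a : R) n : (0 < n)%N -> 0 <= a -> (a ^+ n) `^ n%:R^-1 = a.
Proof.
move=> n0 a0; rewrite -powR_mulrn // -powRrM mulfV ?powRr1 //.
by rewrite pnatr_eq0 -lt0n.
Qed.

Lemma powR_exprn (R : realType) (a p : R) n : 0 <= a -> (a ^+ n) `^ p = (a `^ p) ^+ n.
Proof.
by move=> a0; rewrite -powR_mulrn // -powRrM mulrC powRrM powR_mulrn // powR_ge0.
Qed.

Lemma powR_le_root (R : realType) (s a : R) n : (0 < n)%N -> 0 <= s -> 0 <= a ->
  s <= a ^+ n -> s `^ n%:R^-1 <= a.
Proof.
move=> n0 s0 a0 sa; rewrite -[X in _ <= X](powR_root n0 a0).
by apply: ge0_ler_powR; rewrite ?nnegrE ?invr_ge0 // exprn_ge0.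
Qed.

Lemma card_words n m : #|{ffun 'I_n -> 'I_m}| = (m ^ n)%N.
Proof. by rewrite card_ffun !card_ord. Qed.

Lemma asymptotic_slice_rank_le (R : realType) (K : fieldType) m1 m2 m3
    (T : tensor K m1 m2 m3) (xi : R * R * R) : Xi xi ->
  (asymptotic_slice_rank xi T <= min_dim_term xi m1 m2 m3)%E.
Proof.
move=> [x1 x2 x3 _].
have main m x : (x != 0 -> forall n, weighted_slice_rank xi (kronecker_power T n)
      <= #|{ffun 'I_n -> 'I_m}|%:R `^ x^-1) ->
    (asymptotic_slice_rank xi T <= dim_term x m)%E.
  move=> h; rewrite /dim_term; have [_|x0] := eqVneq x 0; first exact: leey.
  apply: (@limn_esup_le _ _ _ 1) => n n0; rewrite lee_fin.
  apply: powR_le_root => //; rewrite ?powR_ge0 ?weighted_slice_rank_ge0 //.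
  by rewrite -powR_exprn // -natrX -card_words; exact: h.
rewrite /min_dim_term !le_min; apply/andP; split; first (apply/andP; split);
apply: main => nz n.
- by have [h _ _] := weighted_slice_rank_dim (kronecker_power T n) x1 x2 x3; exact: h.
- by have [_ h _] := weighted_slice_rank_dim (kronecker_power T n) x1 x2 x3; exact: h.
- by have [_ _ h] := weighted_slice_rank_dim (kronecker_power T n) x1 x2 x3; exact: h.
Qed.

(** In an empty format the only tensor is 0, which lies in its own orbit. *)
Lemma semistable_dim_gt0 (K : fieldType) (L : closedFieldType)
    (iota : {rmorphism K -> L}) m1 m2 m3 (T : tensor K m1 m2 m3) :
  semistable iota T -> (0 < m1 * m2 * m3)%N.
Proof.
rewrite lt0n => ss; apply/eqP => M0; apply: ss => p; apply.
exists 1%:M, 1%:M, 1%:M; split; rewrite ?det1 //.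
apply/ffunP => x; have : #|{: 'I_m1 * 'I_m2 * 'I_m3}| = 0%N by rewrite !card_prod !card_ord.
by move/card0_eq/(_ x); rewrite inE.
Qed.

(** For x != 0 the bounds read r < (c^x)^n and c^x < m, so r is exponentially smaller than m^n. The
    factor 3 makes the three quotients r_i / m_i^n add up to less than 1. *)
Lemma slice_count_lt (R : realType) (x c : R) m : 0 <= x -> 0 < c -> (0 < m)%N ->
  (x != 0 -> c < m%:R `^ x^-1) ->
  exists N, forall n r, (N <= n)%N -> (x = 0 -> r = 0%N) ->
    slice_term x r < c ^+ n -> (3 * r < m ^ n)%N.
Proof.
move=> x0 c0 m0 cm; have [xz|xn0] := eqVneq x 0.
  by exists 0%N => n r _ /(_ xz) -> _; rewrite muln0 expn_gt0 m0.
have m0' : 0 < m%:R :> R by rewrite ltr0n.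
have xp : 0 < x by rewrite lt_neqAle eq_sym xn0.
have root (a : R) : 0 <= a -> (a `^ x^-1) `^ x = a.
  by move=> a0; rewrite -powRrM mulVf // powRr1.
pose t := c `^ x / m%:R.
have t0 : 0 <= t by rewrite divr_ge0 ?powR_ge0 // ltW.
have t1 : t < 1.
  rewrite /t ltr_pdivrMr // mul1r -[X in _ < X]root ?ltW //.
  by apply: gt0_ltr_powR; rewrite ?nnegrE ?powR_ge0 ?(ltW c0) // cm.
have [|N NP] := @expr_eventually_le R t (1 / 3) t0 t1; first by lra.
exists N => n r Nn _; rewrite /slice_term (negPf xn0) => rc.
have r_lt : r%:R < (c `^ x) ^+ n.
  rewrite -powR_exprn ?(ltW c0) // -[X in X < _]root ?ler0n //.
  by apply: gt0_ltr_powR; rewrite ?nnegrE ?powR_ge0 ?exprn_ge0 ?(ltW c0).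
have := NP n Nn; rewrite /t expr_div_n ler_pdivrMr ?exprn_gt0 // => le.
by rewrite -(ltr_nat R) natrM natrX; lra.
Qed.

Lemma thirds_lt a b d r1 r2 r3 : (0 < a)%N -> (0 < b)%N -> (0 < d)%N ->
  (3 * r1 < a)%N -> (3 * r2 < b)%N -> (3 * r3 < d)%N ->
  (r1 * (b * d) + r2 * (a * d) + r3 * (a * b) < a * b * d)%N.
Proof.
move=> a0 b0 d0 l1 l2 l3.
have h1 : (3 * r1 * (b * d) < a * (b * d))%N by rewrite ltn_pmul2r // muln_gt0 b0.
have h2 : (3 * r2 * (a * d) < b * (a * d))%N by rewrite ltn_pmul2r // muln_gt0 a0.
have h3 : (3 * r3 * (a * b) < d * (a * b))%N by rewrite ltn_pmul2r // muln_gt0 a0.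
have e2 : (b * (a * d) = a * (b * d))%N by rewrite mulnCA.
have e3 : (d * (a * b) = a * (b * d))%N by rewrite mulnC mulnA.
rewrite -!mulnA in h1 h2 h3; rewrite e2 in h2; rewrite e3 in h3.
by rewrite -mulnA; lia.
Qed.

Lemma asymptotic_slice_rank_ge (R : realType) (K : fieldType) (L : closedFieldType)
    (iota : {rmorphism K -> L}) m1 m2 m3 (T : tensor K m1 m2 m3) (xi : R * R * R) :
  (forall k, (0 < k)%N -> semistable iota (kronecker_power T k)) -> Xi xi ->
  (min_dim_term xi m1 m2 m3 <= asymptotic_slice_rank xi T)%E.
Proof.
move=> ss Xxi; have [x1 x2 x3 _] := Xxi.
rewrite leNgt; apply/negP => lt.
have [m10 m20 m30] : [/\ (0 < m1)%N, (0 < m2)%N & (0 < m3)%N].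
  have := semistable_dim_gt0 (ss 1%N isT); rewrite !card_words !expn1 !muln_gt0.
  by move=> /andP[/andP[]].
have [c ltc cmin] : exists2 c : R, (asymptotic_slice_rank xi T < c%:E)%E &
    (c%:E < min_dim_term xi m1 m2 m3)%E.
  case: (asymptotic_slice_rank xi T) (min_dim_term xi m1 m2 m3) lt => [a| |] [b| |] //.
  - by rewrite lte_fin => ab; exists ((a + b) / 2); rewrite lte_fin; lra.
  - by exists (a + 1); rewrite ?ltry // lte_fin ltrDl.
  - by exists (b - 1); rewrite ?ltNyr // lte_fin ltrBlDr ltrDl.
  - by exists 0; rewrite ?ltNyr ?ltry.
have [N NP] := limn_esup_lt ltc.
have c0 : 0 < c.
  have := NP N.+1 (leqnSn N); rewrite lte_fin; apply: le_lt_trans; exact: powR_ge0.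
have bound m x : (c%:E < dim_term x m)%E -> x != 0 -> c < m%:R `^ x^-1.
  by move=> + xn0; rewrite /dim_term (negPf xn0) lte_fin.
move: cmin; rewrite /min_dim_term !lt_min => /andP[/andP[c1 c2] c3].
have [N1 P1] := slice_count_lt x1 c0 m10 (bound _ _ c1).
have [N2 P2] := slice_count_lt x2 c0 m20 (bound _ _ c2).
have [N3 P3] := slice_count_lt x3 c0 m30 (bound _ _ c3).
pose n := (N + N1 + N2 + N3).+1.
have [nN nN1 nN2 nN3] : [/\ (N <= n)%N, (N1 <= n)%N, (N2 <= n)%N & (N3 <= n)%N].
  by rewrite /n; clear; split; lia.
have S_lt : weighted_slice_rank xi (kronecker_power T n) < c ^+ n.
  have := NP n nN; rewrite lte_fin => h.
  have S0 := weighted_slice_rank_ge0 xi (kronecker_power T n).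
  have -> : weighted_slice_rank xi (kronecker_power T n) =
      (weighted_slice_rank xi (kronecker_power T n) `^ n%:R^-1) ^+ n.
    by rewrite -powR_mulrn ?powR_ge0 // -powRrM mulVf ?powRr1 ?pnatr_eq0.
  by rewrite ltrXn2r ?nnegrE ?powR_ge0 // ltW.
have [r1 [r2 [r3 [dec [z1 z2 z3] t1 t2 t3]]]] := weighted_slice_rank_lt Xxi S_lt.
have l1 : (3 * r1 < m1 ^ n)%N by exact: P1.
have l2 : (3 * r2 < m2 ^ n)%N by exact: P2.
have l3 : (3 * r3 < m3 ^ n)%N by exact: P3.
apply: (slices_unstable (iota := iota) _ dec) (ss n isT).
  by rewrite !card_words !muln_gt0 !expn_gt0 m10 m20 m30.
rewrite !card_words.
have M1 : (0 < m1 ^ n)%N by rewrite expn_gt0 m10.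
have M2 : (0 < m2 ^ n)%N by rewrite expn_gt0 m20.
have M3 : (0 < m3 ^ n)%N by rewrite expn_gt0 m30.
exact: thirds_lt.
Qed.

(* Equal terms m_i^(1/xi_i), so that an exponential gain in any direction is a
   gain for the weighted slice rank. *)
Lemma equalizing_weight (R : realType) m1 m2 m3 : (0 < m1 + m2 + m3)%N ->
  exists (xi : R * R * R) (mu : R),
  [/\ Xi xi, 1 <= mu, min_dim_term xi m1 m2 m3 = mu%:E &
    forall x m, ((x, m) \in [:: (xi.1.1, m1); (xi.1.2, m2); (xi.2, m3)]) ->
      [/\ 0 <= x, x <= 1, x != 0 -> m%:R `^ x^-1 = mu & x = 0 -> (m <= 1)%N]].
Proof.
move=> m0; pose M := maxn (maxn m1 m2) m3.
have M0 : (0 < M)%N by rewrite /M !leq_max; lia.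
(* For M = 1 the logarithms vanish and m itself is the weight. As [ln 0] is 0, the dimensions 0 and
   1 both get weight 0 when M > 1. *)
pose w m : R := if M == 1%N then m%:R else ln m%:R / ln M%:R.
have lnM : M != 1%N -> 0 < ln M%:R :> R.
  by move=> M1; rewrite ln_gt0 // ltr1n ltn_neqAle eq_sym M1.
have wM : w M = 1.
  by rewrite /w; have [->//|M1] := eqVneq M 1%N; rewrite divff // gt_eqF // lnM.
have ln_ge m : 0 <= ln m%:R :> R.
  case: m => [|m]; first by rewrite ln0.
  by rewrite ln_ge0 // ler1n.
have w0 m : 0 <= w m.
  rewrite /w; case: (eqVneq M 1%N) => [_|M1]; first exact: ler0n.
  by rewrite divr_ge0 // ltW // lnM.
have w1 m : (m <= M)%N -> w m <= 1.
  rewrite /w; case: (eqVneq M 1%N) => [->|M1] mM; first by rewrite lern1.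
  rewrite ler_pdivrMr ?lnM // mul1r; case: m mM => [|m] mM.
    by rewrite ln0 // ltW // lnM.
  by rewrite ler_ln ?posrE ?ltr0n // ler_nat.
have wmu m : (m <= M)%N -> w m != 0 -> m%:R `^ (w m)^-1 = M%:R :> R.
  rewrite /w; case: (eqVneq M 1%N) => [E|M1] mM.
    rewrite pnatr_eq0 => mn0; have -> : m = 1%N by lia.
    by rewrite powR1 E.
  move=> wn0; have mn0 : m%:R != 0 :> R.
    by apply: contraNneq wn0 => ->; rewrite ln0 // mul0r.
  have lm : ln m%:R != 0 :> R by apply: contraNneq wn0 => ->; rewrite mul0r.
  by rewrite /powR (negPf mn0) invf_div divfK // lnK // posrE ltr0n.
have wz m : w m = 0 -> (m <= 1)%N.
  rewrite /w; case: (eqVneq M 1%N) => [_ /eqP|M1 /eqP]; first by rewrite pnatr_eq0 => /eqP ->.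
  rewrite mulf_eq0 invr_eq0 (gt_eqF (lnM M1)) orbF => /eqP lm.
  by rewrite leqNgt; apply/negP => mgt1; move: (@ln_gt0 R m%:R); rewrite lm ltr1n ltxx => /(_ mgt1).
have [l1 l2 l3] : [/\ (m1 <= M)%N, (m2 <= M)%N & (m3 <= M)%N] by rewrite /M; split; lia.
exists (w m1, w m2, w m3), M%:R; split => /=.
- split=> //=; apply/eqP; rewrite eq_le !ge_max !w1 //= !le_max -wM.
  have : [|| M == m1, M == m2 | M == m3] by rewrite /M; lia.
  by case/or3P => /eqP <-; rewrite lexx ?orbT.
- by rewrite ler1n.
- apply/eqP; rewrite eq_le /min_dim_term /=; apply/andP; split.
    have d m : M = m -> (dim_term (w m) m <= M%:R%:E)%E.
      move=> <-; rewrite /dim_term wM oner_eq0 invr1 powRr1 ?ler0n //.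
    have : [|| M == m1, M == m2 | M == m3] by rewrite /M; lia.
    by rewrite !ge_min; case/or3P => /eqP /d ->; rewrite ?orbT.
  have d m : (m <= M)%N -> (M%:R%:E <= dim_term (w m) m)%E.
    move=> mM; rewrite /dim_term; case: eqVneq => [_|wn0]; first exact: leey.
    by rewrite wmu.
  by rewrite !le_min !d.
move=> x m; rewrite !inE => /or3P[] /eqP[-> ->]; split => //;
  by [exact: w1|exact: wmu|exact: wz].
Qed.

(** The power n = 0 is excluded because its format is 1 x 1 x 1 even when some m_i is 0. *)
Lemma empty_small_slices (R : realType) (K : fieldType) m1 m2 m3
    (T : tensor K m1 m2 m3) (rho : R) n : (m1 * m2 * m3 = 0)%N -> (0 < n)%N ->
  0 <= rho -> small_slices T rho n.
Proof.
move=> M0 n0 rho0; exists 0%N, 0%N, 0%N; split; rewrite ?mulr0 ?exprn_ge0 ?mulr_ge0 //.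
exists void, void, void; split; rewrite ?card_void //.
do 6!exists (of_void _); move=> x y z.
have : #|{: 'I_#|{ffun 'I_n -> 'I_m1}| * 'I_#|{ffun 'I_n -> 'I_m2}| *
    'I_#|{ffun 'I_n -> 'I_m3}|}| = 0%N.
  by rewrite !card_prod !card_ord !card_words -!expnMn M0 exp0n.
by move/card0_eq/(_ (x, y, z)); rewrite inE.
Qed.

(** If xi_i > 0, raising r_i <= (rho^n / 3) m_i^n to the power 1/xi_i >= 1 can only shrink rho^n / 3
    and turns m_i^n into mu^n. If xi_i = 0, then m_i <= 1 forces r_i = 0, as the definition of the
    weighted slice rank demands. *)
Lemma small_slices_asymptotic (R : realType) (K : fieldType) m1 m2 m3
    (T : tensor K m1 m2 m3) (rho : R) N : (0 < m1 + m2 + m3)%N ->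
  0 < rho -> rho < 1 -> (forall n, (N <= n)%N -> small_slices T rho n) ->
  exists2 xi : R * R * R, Xi xi & (asymptotic_slice_rank xi T < min_dim_term xi m1 m2 m3)%E.
Proof.
move=> m0 rho0 rho1 small.
have [xi [mu [Xxi mu1 minE wP]]] := equalizing_weight R m0; exists xi => //.
rewrite minE.
have [x1 x2 x3 _] := Xxi.
have mu0 : 0 < mu by exact: lt_le_trans mu1.
apply: (@le_lt_trans _ _ (rho * mu)%:E); last by rewrite lte_fin gtr_pMl.
apply: (@limn_esup_le _ _ _ N.+1) => n Nn; rewrite lee_fin.
have n0 : (0 < n)%N by exact: leq_trans Nn.
apply: powR_le_root => //; rewrite ?weighted_slice_rank_ge0 // ?mulr_ge0 ?(ltW mu0) ?(ltW rho0) //.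
have [r1 [r2 [r3 [sl b1 b2 b3]]]] := small n (ltnW Nn).
have rho_n : rho ^+ n <= 1 by rewrite exprn_ile1 // ltW.
have rz x m r : (x, m) \in [:: (xi.1.1, m1); (xi.1.2, m2); (xi.2, m3)] ->
    3 * r%:R <= (rho * m%:R) ^+ n -> x = 0 -> r = 0%N.
  move=> /wP[_ _ _ h] + /h m_le1; rewrite exprMn => le.
  have m1' : m%:R ^+ n <= 1 :> R by rewrite exprn_ile1 // lern1.
  have : 3 * r%:R <= 1 :> R.
    apply: le_trans le _; rewrite -[X in _ <= X]mulr1.
    by apply: ler_pM; rewrite ?exprn_ge0 // ltW.
  by rewrite -natrM lern1; case: r {le} => [|k] //; rewrite mulnS.
have term x m r : (x, m) \in [:: (xi.1.1, m1); (xi.1.2, m2); (xi.2, m3)] ->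
    3 * r%:R <= (rho * m%:R) ^+ n -> slice_term x r <= (rho * mu) ^+ n / 3.
  move=> xm le; have [x0 xle1 muE _] := wP _ _ xm; rewrite /slice_term.
  case: eqVneq => [_|xn0].
    by rewrite divr_ge0 // exprn_ge0 // mulr_ge0 // ltW.
  have xp : 0 < x by rewrite lt_neqAle eq_sym xn0.
  have a0 : 0 < rho ^+ n / 3 by rewrite divr_gt0 // exprn_gt0.
  apply: (@le_trans _ _ ((rho ^+ n / 3 * m%:R ^+ n) `^ x^-1)).
    apply: ge0_ler_powR; rewrite ?nnegrE ?invr_ge0 ?ler0n //.
      by rewrite mulr_ge0 ?exprn_ge0 // ltW.
    by move: le; rewrite exprMn; lra.
  rewrite powRM ?exprn_ge0 ?(ltW a0) // powR_exprn // muE // exprMn mulrAC.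
  rewrite ler_pM2r ?exprn_gt0 // -[X in _ <= X]powRr1 ?(ltW a0) //.
  apply: ger_powR; last by rewrite invf_ge1.
  by rewrite a0 /=; lra.
apply: (le_trans (weighted_slice_rank_le x1 x2 x3 sl _ _ _)).
- by apply: rz b1; rewrite !inE eqxx.
- by apply: rz b2; rewrite !inE eqxx orbT.
- by apply: rz b3; rewrite !inE eqxx !orbT.
have t1 : slice_term xi.1.1 r1 <= (rho * mu) ^+ n / 3 by apply: term b1; rewrite !inE eqxx.
have t2 : slice_term xi.1.2 r2 <= (rho * mu) ^+ n / 3 by apply: term b2; rewrite !inE eqxx orbT.
have t3 : slice_term xi.2 r3 <= (rho * mu) ^+ n / 3 by apply: term b3; rewrite !inE eqxx !orbT.
lra.
Qed.

(** [m_neq0] excludes the format 0 x 0 x 0, where no power is semistable although G_xi and the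
    minimum are both 0 for every xi. *)
Theorem theorem3p5 (R : realType) (K : fieldType) (Kbar : closedFieldType)
    (iota : {rmorphism K -> Kbar}) (closureK : is_algebraic_closure iota)
    (m1 m2 m3 : nat) (m_neq0 : (0 < m1 + m2 + m3)%N)
    (T : tensor K m1 m2 m3) :
  (forall k : nat, (0 < k)%N -> semistable iota (kronecker_power T k)) <->
  (forall xi : R * R * R, Xi xi ->
     asymptotic_slice_rank xi T = min_dim_term xi m1 m2 m3).
Proof.
split=> [ss xi Xxi|eqG k k0].
  apply/eqP; rewrite eq_le asymptotic_slice_rank_le //=.
  exact: asymptotic_slice_rank_ge ss Xxi.
apply: contrapT => nss.
suff [rho [rho0 rho1 [N small]]] : exists rho : R, [/\ 0 < rho, rho < 1 &
    exists N, forall n, (N <= n)%N -> small_slices T rho n].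
  have [xi Xxi] := small_slices_asymptotic m_neq0 rho0 rho1 small.
  by rewrite eqG // ltxx.
(* In an empty format the decomposition without slices allows any positive rate, such as 1/2. *)
have [M0|M0] := posnP (m1 * m2 * m3); last exact: unstable_small_slices nss.
exists (1 / 2); split; [lra|lra|exists 1%N => n n0].
by apply: empty_small_slices => //; lra.
Qed.
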